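(* For every $n\in\mathbb Z$, under the identification $p_m\mapsto p_m(x)=x_1^m+x_2^m+\cdots$ $(m\ge1)$, one has $$GQ_n(x)=\langle0|e^{\mathcal H^{(\beta)}}\phi^{(\beta)}_ne^{\Theta}\phi^{(\beta)}_0e^{\Theta}|0\rangle .$$
   Context: **Fermions.** $k=\mathbb Q(\beta)$ with $\beta$ an indeterminate; $[A,B]_+=AB+BA$. $\mathcal A$ is the unital associative $k$-algebra generated by $\phi_n$ ($n\in\mathbb Z$) with relations $[\phi_m,\phi_n]_+=2(-1)^m\delta_{m+n,0}$. $\mathcal F$ is the left $\mathcal A$-module generated by a vector $|0\rangle$ with $\phi_{-n}|0\rangle=0$ for $n>0$; it has $k$-basis $\phi_{n_1}\cdots\phi_{n_r}|0\rangle$ ($r\ge0$, $n_1>\dots>n_r\ge0$). $\mathcal E$ is the right $\mathcal A$-module generated by $\langle 0|$ with $\langle 0|\phi_n=0$ for $n>0$; it has $k$-basis $\langle0|\phi_{m_1}\cdots\phi_{m_r}$ ($r\ge0$, $0\ge m_1>\dots>m_r$). There is a bilinear pairing $\mathcal E\otimes_k\mathcal F\to k$, $\langle w|\otimes|v\rangle\mapsto\langle w|v\rangle$, determined by $\langle0|0\rangle=1$, $(\langle w|X)|v\rangle=\langle w|(X|v\rangle)$ for $X\in\mathcal A$, and $\langle0|\phi_0|0\rangle=0$. For odd $m\in\mathbb Z$, $b_m=\frac14\sum_{i\in\mathbb Z}(-1)^i\phi_{-i-m}\phi_i$ (acting on $\mathcal E$ and $\mathcal F$). **Deformed operators.** $\phi^{(\beta)}_n$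 ($n\in\mathbb Z$) is defined by $\sum_{n\ge0}\phi^{(\beta)}_nz^n=\sum_{n\ge0}\phi_n(z+\frac\beta2)^n$ and $\sum_{n>0}\phi^{(\beta)}_{-n}z^{-n}=\sum_{n>0}\phi_{-n}\left(\frac{z^{-1}}{1+\frac\beta2z^{-1}}\right)^n$. These may be infinite sums but act on $\mathcal E$ from the right (on each vector only finitely many terms are nonzero). For $m\ge 1$, $b^{(\beta)}_m$ is obtained from the polynomial $\frac{(X-\frac\beta2)^m-(-X-\frac\beta2)^m}{2}$ by replacing $X^l\mapsto b_l$ (only odd $l$ occur). Put $\mathcal H^{(\beta)}=2\sum_{n\ge1}\frac{p_n}{n}b^{(\beta)}_n$ with commuting indeterminates $p_1,p_2,\dots$; $e^{\mathcal H^{(\beta)}}$ maps $\mathcal E$ to $\mathcal E[[p]]=\mathcal E[[p_1,p_2,\dots]]$. Put $\Theta=2\left(\frac\beta2b_{-1}+\frac{\beta^3}{2^3}\frac{b_{-3}}3+\frac{\beta^5}{2^5}\frac{b_{-5}}5+\cdots\right)$; $\Theta$ and $e^\Theta$ act on $\mathcal E$ from the right. An expression $\langle0|O_1O_2\cdots O_l|0\rangle$ means: apply $O_1$, then $O_2$, $\dots$, then $O_l$ to $\langle0|$ from the right, and pair the result (coefficientwise in the $p_i$) with $|0\rangle$. **The functions $GQ_n$.** The $K$-theoretic $Q$-functions $GQ_n(x)$, $n\in\mathbb Z$, in the variables $x=(x_1,x_2,\dots)$ are given by the generating function $$\sum_{n\in\mathbb Z}GQ_n(x)z^n=\frac1{1+\beta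 z^{-1}}\prod_{i=1}^\infty\frac{1+(z+\beta)x_i}{1+(z+\beta)\overline{x_i}},\qquad \overline{x}=\frac{-x}{1+\beta x},$$ where $(1+\beta z^{-1})^{-1}$ is expanded as $1-\beta z^{-1}+\beta^2z^{-2}-\cdots$. (For $n\ge1$ this is the $K$-theoretic $Q$-function of the one-row partition $(n)$.) *)

(* Defs.v *)
From HB Require Import structures.
From mathcomp Require Import all_boot all_order all_algebra.
From mathcomp Require Import generic_quotient ring_quotient.
From mathcomp Require Import finmap monalg ring.
From mathcomp Require Import boolp classical_sets functions cardinality fsbigop.

Set Implicit Arguments.
Unset Strict Implicit.
Unset Printing Implicit Defensive.

Import GRing.Theory.
Local Open Scope classical_set_scope.
Local Open Scope ring_scope.
Local Open Scope quotient_scope.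

Notation "1" := (@mone _) : monom_scope.
Notation "x * y" := (mmul x y) : monom_scope.

(** Infinite sums are written [\sum_(i \in A) F i] (fsbigop): the sum of the
    nonzero terms, provided that there are finitely many of them. *)

(** [f m] is the coefficient of the monomial [m]. *)
Definition fps (I : choiceType) (R : Type) : Type := {cmonom I} -> R.

Section FormalPowerSeries.
Context (I : choiceType) (R : comNzRingType).
Local Notation S := (fps I R).
Implicit Types (f g h : S) (m d e : {cmonom I}).

Definition fps_zero : S := fun=> 0.
Definition fps_opp f : S := fun m => - f m.
Definition fps_add f g : S := fun m => f m + g m.
Definition fps_const (c : R) : S := fun m => c *+ (m == 1%M).
Definition fps_mul f g : S :=
  fun m => \sum_(d \in [set d : {cmonom I} * {cmonom I} | (d.1 * d.2)%M = m])
             f d.1 * g d.2.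
Definition fps_var (i : I) : S := fun m => (m == ucm i)%:R.

Fact fps_addA : associative fps_add.
Proof. by move=> f g h; apply/funext => m; rewrite /fps_add addrA. Qed.
Fact fps_addC : commutative fps_add.
Proof. by move=> f g; apply/funext => m; rewrite /fps_add addrC. Qed.
Fact fps_add0 : left_id fps_zero fps_add.
Proof. by move=> f; apply/funext => m; rewrite /fps_add add0r. Qed.
Fact fps_addN : left_inverse fps_zero fps_opp fps_add.
Proof. by move=> f; apply/funext => m; rewrite /fps_add addNr. Qed.

HB.instance Definition _ := gen_eqMixin (fps I R).
HB.instance Definition _ := gen_choiceMixin (fps I R).
HB.instance Definition _ :=
  GRing.isZmodule.Build (fps I R) fps_addA fps_addC fps_add0 fps_addN.

Lemma finite_divisors m : finite_set [set d | exists e, (d * e)%M = m].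
Proof.
pose F (d : {cmonom I}) : {ffun finsupp m -> 'I_(mdeg m).+1} :=
  [ffun i => inord (d (val i))].
have bnd d e i : (d * e)%M = m -> (d i <= m i)%N.
  by move=> <-; rewrite cmM leq_addr.
have mle i : (m i <= mdeg m)%N.
  case: (finsuppP m i) => // im.
  by rewrite mdegE (big_fsetD1 i im)/= leq_addr.
suff /inj_card_eq /card_eqPle [_ le] :
    {in [set d | exists e, (d * e)%M = m] &, injective F}.
  exact: card_le_finite le finite_finset.
move=> d d'; rewrite !inE => -[e de] [e' de'] /ffunP eqF.
apply/eqP/cmP => i; case: (finsuppP m i) => [im|im].
  have m0 : m i = 0%N by apply/eqP; rewrite cmE_eq0.
  have := bnd _ _ i de; have := bnd _ _ i de'.
  by rewrite m0 !leqn0 => /eqP-> /eqP->.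
have := eqF [` im]%fset; rewrite !ffunE /= => /(congr1 val).
by rewrite /= !inordK // ltnS (leq_trans _ (mle i)) ?(bnd _ _ _ de) ?(bnd _ _ _ de').
Qed.

Definition divisors_of m : seq {cmonom I} :=
  fset_set [set d | exists e, (d * e)%M = m].

Lemma mem_divisors_of m d e : (d * e)%M = m -> d \in divisors_of m.
Proof.
move=> de; rewrite /divisors_of in_fset_set; last exact: finite_divisors.
by rewrite inE; exists e.
Qed.

Lemma mem_divisors_ofr m d e : (d * e)%M = m -> e \in divisors_of m.
Proof. by rewrite mulmC; apply: mem_divisors_of. Qed.

Lemma uniq_divisors_of m : uniq (divisors_of m).
Proof. exact: fset_uniq. Qed.

Lemma fps_mulE (D : seq {cmonom I}) f g m : uniq D ->
    (forall d e, (d * e)%M = m -> (d \in D) && (e \in D)) ->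
  fps_mul f g m =
  \sum_(d <- D) \sum_(e <- D) (f d * g e) *+ ((d * e)%M == m).
Proof.
move=> uD mD; transitivity
  (\sum_(p <- [seq (d, e) | d <- D, e <- D] | (p.1 * p.2)%M == m)
     f p.1 * g p.2); last first.
  rewrite big_mkcond !big_allpairs_dep /=; apply: eq_bigr => d _.
  by apply: eq_bigr => e _; rewrite mulrb.
rewrite /fps_mul (fsbigE [seq p <- [seq (d, e) | d <- D, e <- D] |
  (p.1 * p.2)%M == m]).
- rewrite big_filter_cond; apply: eq_bigl => p.
  by apply/andP/idP => [[]//|pm]; split=> //; rewrite inE; apply/eqP.
- by rewrite filter_uniq // allpairs_uniq // => -[? ?] [? ?].
- by move=> p /=; rewrite mem_filter => /andP[/eqP].
- move=> [d e] /= de; rewrite mem_filter /= de eqxx /= => /negP[].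
  by have /andP[dD eD] := mD _ _ de; apply/allpairsP; exists (d, e).
Qed.

Lemma fps_mulDE f g m :
  fps_mul f g m =
  \sum_(d <- divisors_of m) \sum_(e <- divisors_of m)
    (f d * g e) *+ ((d * e)%M == m).
Proof.
apply: fps_mulE => [|d e de]; first exact: uniq_divisors_of.
by rewrite (mem_divisors_of de) (mem_divisors_ofr de).
Qed.

Fact fps_mulC : commutative fps_mul.
Proof.
move=> f g; apply/funext => m; rewrite !fps_mulDE exchange_big /=.
by apply: eq_bigr => d _; apply: eq_bigr => e _; rewrite mulrC mulmC.
Qed.

Fact fps_mulDl : left_distributive fps_mul fps_add.
Proof.
move=> f g h; apply/funext => m; rewrite /fps_add !fps_mulDE -big_split /=.
apply: eq_bigr => d _; rewrite -big_split /=.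
by apply: eq_bigr => e _; rewrite mulrDl mulrnDl.
Qed.

Fact fps_mul1 : left_id (fps_const 1) fps_mul.
Proof.
move=> f; apply/funext => m; rewrite fps_mulDE.
rewrite (bigD1_seq 1%M) ?uniq_divisors_of ?(mem_divisors_of (mul1m m)) //=.
rewrite [X in _ + X]big1 ?addr0; last first.
  move=> d /negPf d1; apply: big1 => e _.
  by rewrite /fps_const d1 mulr0n mul0r mul0rn.
rewrite (bigD1_seq m) ?uniq_divisors_of ?(mem_divisors_ofr (mul1m m)) //=.
rewrite big1 ?addr0; last by move=> d /negPf dm; rewrite mul1m dm mulr0n.
by rewrite /fps_const mul1m !eqxx !mulr1n mul1r.
Qed.

Fact fps_mulA : associative fps_mul.
Proof.
have tripleE f g h m : fps_mul f (fps_mul g h) m =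
    \sum_(a <- divisors_of m) \sum_(b <- divisors_of m)
      \sum_(c <- divisors_of m) (f a * g b * h c) *+ ((a * (b * c))%M == m).
  rewrite fps_mulDE; apply: eq_bigr => a _.
  transitivity (\sum_(e <- divisors_of m) \sum_(b <- divisors_of m)
     \sum_(c <- divisors_of m)
       (f a * g b * h c) *+ (((b * c)%M == e) && ((a * e)%M == m))).
    apply: eq_bigr => e _; have [ae|_] := eqVneq; last first.
      rewrite mulr0n big1 // => b _; apply: big1 => c _.
      by rewrite andbF mulr0n.
    rewrite mulr1n (@fps_mulE (divisors_of m)) ?uniq_divisors_of //; last first.
      move=> b c bc; apply/andP; split.
        by apply: (@mem_divisors_of _ _ (c * a)%M); rewrite mulmA bc mulmC.
      by apply: (@mem_divisors_ofr _ (a * b)%M); rewrite -mulmA bc.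
    rewrite mulr_sumr; apply: eq_bigr => b _; rewrite mulr_sumr.
    by apply: eq_bigr => c _; rewrite andbT mulrnAr mulrA.
  rewrite exchange_big /=; apply: eq_bigr => b _.
  rewrite exchange_big /=; apply: eq_bigr => c _.
  have [abc|abc] := eqVneq (a * (b * c))%M m; last first.
    rewrite mulr0n big1 // => e _; have [bc|] := eqVneq; rewrite ?mulr0n //=.
    by rewrite -bc (negPf abc) mulr0n.
  rewrite (bigD1_seq (b * c)%M) ?uniq_divisors_of ?(mem_divisors_ofr abc) //=.
  rewrite abc !eqxx /= big1 ?addr0 // => e /negPf be.
  by rewrite eq_sym be mulr0n.
move=> f g h; apply/funext => m; rewrite tripleE fps_mulC tripleE.
rewrite [RHS](eq_bigr (fun a => \sum_(b <- divisors_of m)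
  \sum_(c <- divisors_of m)
    (f b * g c * h a) *+ ((b * (c * a))%M == m))); last first.
  move=> a _; apply: eq_bigr => b _; apply: eq_bigr => c _.
  by rewrite -mulrA mulrC [(a * _)%M]mulmC mulmA.
rewrite [RHS]exchange_big /=; apply: eq_bigr => a _.
by rewrite exchange_big.
Qed.

Fact fps_oner_neq0 : fps_const 1 != 0 :> S.
Proof.
apply/eqP => /(congr1 (fun f : S => f 1%M)) /eqP.
by rewrite /fps_const eqxx mulr1n oner_eq0.
Qed.

HB.instance Definition _ := GRing.Zmodule_isComNzRing.Build (fps I R)
  fps_mulA fps_mulC fps_mul1 fps_mulDl fps_oner_neq0.

Definition fps_unit : pred S := fun f => `[< exists g, g * f = 1 >].
Definition fps_inv f : S := if fps_unit f then xget 0 [set g | g * f = 1] else f.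

Fact fps_mulV : {in fps_unit, left_inverse 1 fps_inv *%R}.
Proof.
move=> f uf; have {}uf : fps_unit f := uf; rewrite /fps_inv uf.
by move/asboolP: uf => [g gf]; case: xgetP => [h _ //|/(_ g)].
Qed.
Fact fps_unitP f g : g * f = 1 -> fps_unit f.
Proof. by move=> gf; apply/asboolP; exists g. Qed.
Fact fps_inv_out : {in [predC fps_unit], fps_inv =1 id}.
Proof. by move=> f; rewrite inE /fps_inv => /negPf uf; rewrite [fps_unit f]uf. Qed.

HB.instance Definition _ := GRing.ComNzRing_hasMulInverse.Build (fps I R)
  fps_mulV fps_unitP fps_inv_out.

(** Limit and infinite product in the coefficientwise discrete topology. *)
Definition fps_converges (u : nat -> S) (l : S) : Prop :=
  forall m, exists N : nat, forall n : nat, (N <= n)%N -> u n m = l m.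

Definition fps_infprod (u : nat -> S) : S :=
  xget 0 [set l | fps_converges (fun N => \prod_(i < N) u i) l].

End FormalPowerSeries.

Arguments fps_const {I R} c.
Arguments fps_var {I R} i.


Inductive zspan (V : zmodType) (G : set V) : V -> Prop :=
| zspan_gen v of G v : zspan G v
| zspan0 : zspan G 0
| zspanB u v of zspan G u & zspan G v : zspan G (u - v).

Definition zspanb (V : zmodType) (G : set V) (v : V) : bool := `[< zspan G v >].

Fact zspanb_closed (V : zmodType) (G : set V) : zmod_closed (zspanb G).
Proof.
split=> [|u v]; rewrite !unfold_in; first by apply/asboolP; constructor.
by move=> /asboolP Gu /asboolP Gv; apply/asboolP; constructor.
Qed.

HB.instance Definition _ (V : zmodType) (G : set V) :=
  GRing.isZmodClosed.Build V (zspanb G) (zspanb_closed G).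

Definition zspan_pred (V : zmodType) (G : set V) : zmodClosed V :=
  GRing.ZmodClosed.clone V (zspanb G) _.

Lemma zspan_predP (V : zmodType) (G : set V) v :
  reflect (zspan G v) (v \in zspan_pred G).
Proof. exact: asboolP. Qed.

Lemma zspan_map (V W : zmodType) (G : set V) (H : set W) (f : V -> W) :
    {morph f : u v / u - v} -> (forall v, G v -> zspan H (f v)) ->
  forall v, v \in zspan_pred G -> f v \in zspan_pred H.
Proof.
move=> fB GH v /zspan_predP Gv; apply/zspan_predP.
elim: Gv => {v} [v /GH //||u v _ IHu _ IHv]; last by rewrite fB; constructor.
by rewrite -[0](subrr (0 : V)) fB subrr; constructor.
Qed.

Fact quot_key : unit. Proof. by []. Qed.

Section QuotientScale.
Context (k : pzRingType) (V : lmodType k) (J : zmodClosed V).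
Hypothesis JZ : forall c v, v \in J -> c *: v \in J.
Local Notation Q := (Quotient.quot J).

Definition quot_scale : k -> Q -> Q :=
  locked_with quot_key (fun c q => \pi_Q (c *: repr q)).

Lemma pi_quot_scale c v : \pi_Q (c *: v) = quot_scale c (\pi_Q v).
Proof.
rewrite /quot_scale locked_withE; apply/eqP.
rewrite -Quotient.idealrBE -scalerBr; apply: JZ.
by rewrite Quotient.idealrBE reprK.
Qed.

Lemma quot_pi_add u v : \pi_Q (u + v) = \pi_Q u + \pi_Q v.
Proof. by rewrite !piE. Qed.

Lemma quot_scaleA a b q : quot_scale a (quot_scale b q) = quot_scale (a * b) q.
Proof.
elim/quotW: q => v; rewrite -(pi_quot_scale b v) -(pi_quot_scale a (b *: v)).
by rewrite scalerA pi_quot_scale.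
Qed.
Lemma quot_scale1 : left_id 1 quot_scale.
Proof. by elim/quotW => v; rewrite -pi_quot_scale scale1r. Qed.
Lemma quot_scaleDr : right_distributive quot_scale +%R.
Proof.
move=> a; elim/quotW => u; elim/quotW => v.
by rewrite -quot_pi_add -(pi_quot_scale a (u + v)) scalerDr quot_pi_add !pi_quot_scale.
Qed.
Lemma quot_scaleDl q : {morph quot_scale^~ q : a b / a + b}.
Proof.
by elim/quotW: q => v a b; rewrite -(pi_quot_scale (a + b) v) scalerDl quot_pi_add !pi_quot_scale.
Qed.
End QuotientScale.


Section QuotientAlgebra.
Context (k : comNzRingType) (V : algType k) (G : set V).

Definition ideal_of : zmodClosed V :=
  zspan_pred [set u | exists x r y, G r /\ u = x * r * y].

Definition quot_alg : Type := Quotient.quot ideal_of.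
HB.instance Definition _ := GRing.Zmodule.on quot_alg.
HB.instance Definition _ := EqQuotient.on quot_alg.

Definition quot_pi (u : V) : quot_alg := \pi_(Quotient.quot ideal_of) u.

Lemma quot_piP u v : reflect (quot_pi u = quot_pi v) (u - v \in ideal_of).
Proof. by rewrite Quotient.idealrBE; apply: eqP. Qed.

Lemma quot_pi_surj (P : quot_alg -> Prop) : (forall u, P (quot_pi u)) -> forall q, P q.
Proof. by move=> Pu; elim/(@quotW _ (Quotient.quot ideal_of)) => u; apply: Pu. Qed.

Lemma quot_piD u v : quot_pi (u + v) = quot_pi u + quot_pi v.
Proof. exact: quot_pi_add. Qed.

Lemma quot_pi0 : quot_pi 0 = 0.
Proof. by apply: (addrI (quot_pi 0)); rewrite -quot_piD !addr0. Qed.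

Lemma quot_pi_repr u : u - repr (quot_pi u) \in ideal_of.
Proof. by apply/quot_piP; rewrite /quot_pi reprK. Qed.

Lemma ideal_ofMl u v : v \in ideal_of -> u * v \in ideal_of.
Proof.
apply: (zspan_map (f := fun w => u * w)) => [a b|w]; first exact: mulrBr.
move=> [x [r [y [Gr ->]]]].
by constructor; exists (u * x), r, y; rewrite !mulrA.
Qed.

Lemma ideal_ofMr u v : v \in ideal_of -> v * u \in ideal_of.
Proof.
apply: (zspan_map (f := fun w => w * u)) => [a b|w]; first exact: mulrBl.
move=> [x [r [y [Gr ->]]]].
by constructor; exists x, r, (y * u); rewrite !mulrA.
Qed.

Lemma ideal_ofZ (c : k) v : v \in ideal_of -> c *: v \in ideal_of.
Proof. by move=> Jv; rewrite -[v]mul1r scalerAl; apply: ideal_ofMl. Qed.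

HB.instance Definition _ := GRing.Zmodule_isLmodule.Build k quot_alg
  (quot_scaleA ideal_ofZ) (quot_scale1 ideal_ofZ)
  (quot_scaleDr ideal_ofZ) (quot_scaleDl ideal_ofZ).

Lemma quot_piZ c u : quot_pi (c *: u) = c *: quot_pi u.
Proof. exact: (pi_quot_scale ideal_ofZ). Qed.

Definition quot_mul : quot_alg -> quot_alg -> quot_alg :=
  locked_with quot_key (fun a b => quot_pi (repr a * repr b)).

Lemma quot_mul_pi u v : quot_mul (quot_pi u) (quot_pi v) = quot_pi (u * v).
Proof.
rewrite /quot_mul locked_withE; apply/esym/quot_piP; set u' := repr _; set v' := repr _.
have -> : u * v - u' * v' = u * (v - v') + (u - u') * v'.
  by rewrite mulrBr mulrBl addrA subrK.
apply: rpredD; first by apply: ideal_ofMl; apply: quot_pi_repr.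
by apply: ideal_ofMr; apply: quot_pi_repr.
Qed.

Fact quot_mulA : associative quot_mul.
Proof.
elim/quot_pi_surj => u; elim/quot_pi_surj => v; elim/quot_pi_surj => w.
by rewrite !quot_mul_pi mulrA.
Qed.
Fact quot_mul1 : left_id (quot_pi 1) quot_mul.
Proof. by elim/quot_pi_surj => u; rewrite quot_mul_pi mul1r. Qed.
Fact quot_mulr1 : right_id (quot_pi 1) quot_mul.
Proof. by elim/quot_pi_surj => u; rewrite quot_mul_pi mulr1. Qed.
Fact quot_mulDl : left_distributive quot_mul +%R.
Proof.
elim/quot_pi_surj => u; elim/quot_pi_surj => v; elim/quot_pi_surj => w.
by rewrite -quot_piD !quot_mul_pi mulrDl quot_piD.
Qed.
Fact quot_mulDr : right_distributive quot_mul +%R.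
Proof.
elim/quot_pi_surj => u; elim/quot_pi_surj => v; elim/quot_pi_surj => w.
by rewrite -quot_piD !quot_mul_pi mulrDr quot_piD.
Qed.

HB.instance Definition _ := GRing.Zmodule_isPzRing.Build quot_alg
  quot_mulA quot_mul1 quot_mulr1 quot_mulDl quot_mulDr.

Lemma quot_pi1 : quot_pi 1 = 1. Proof. by []. Qed.

Lemma quot_piM u v : quot_pi (u * v) = quot_pi u * quot_pi v.
Proof. by rewrite -quot_mul_pi. Qed.

Lemma quot_pi_rel r : G r -> quot_pi r = 0.
Proof.
move=> Gr; rewrite -quot_pi0; apply/quot_piP; rewrite subr0; apply/zspan_predP; constructor.
by exists 1, r, 1; rewrite mul1r mulr1.
Qed.

Lemma quot_pi_anticomm u v (c : k) : G (u * v + v * u - c%:A) ->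
  quot_pi u * quot_pi v + quot_pi v * quot_pi u = c *: (1 : quot_alg).
Proof.
move=> /quot_pi_rel uv; rewrite -!quot_piM -quot_piD -quot_pi1 -quot_piZ.
by rewrite -[u * v + v * u](subrK c%:A) quot_piD uv add0r.
Qed.

Fact quot_scalerAl (c : k) (a b : quot_alg) : c *: (a * b) = c *: a * b.
Proof.
elim/quot_pi_surj: a => u; elim/quot_pi_surj: b => v.
by rewrite -quot_piM -!quot_piZ -quot_piM scalerAl.
Qed.
Fact quot_scalerAr (c : k) (a b : quot_alg) : c *: (a * b) = a * (c *: b).
Proof.
elim/quot_pi_surj: a => u; elim/quot_pi_surj: b => v.
by rewrite -quot_piM -!quot_piZ -quot_piM scalerAr.
Qed.

End QuotientAlgebra.

Section CyclicModules.
Context (k : comNzRingType) (V : algType k) (G : set V).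
Local Notation A := (quot_alg G).
Variable S : set A.

Definition lideal_of : zmodClosed A :=
  zspan_pred [set u | exists a s, S s /\ u = a * s].
Definition rideal_of : zmodClosed A :=
  zspan_pred [set u | exists s a, S s /\ u = s * a].

Lemma lideal_ofM a v : v \in lideal_of -> a * v \in lideal_of.
Proof.
apply: (zspan_map (f := fun w => a * w)) => [u w|w]; first exact: mulrBr.
by move=> [b [s [Ss ->]]]; constructor; exists (a * b), s; rewrite mulrA.
Qed.
Lemma lideal_ofZ (c : k) v : v \in lideal_of -> c *: v \in lideal_of.
Proof. by move=> Jv; rewrite -[v]mul1r quot_scalerAl; apply: lideal_ofM. Qed.

Lemma rideal_ofM a v : v \in rideal_of -> v * a \in rideal_of.
Proof.
apply: (zspan_map (f := fun w => w * a)) => [u w|w]; first exact: mulrBl.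
by move=> [s [b [Ss ->]]]; constructor; exists s, (b * a); rewrite mulrA.
Qed.
Lemma rideal_ofZ (c : k) v : v \in rideal_of -> c *: v \in rideal_of.
Proof. by move=> Jv; rewrite -[v]mulr1 quot_scalerAr; apply: rideal_ofM. Qed.

(** The left [A]-module with one generator [lgen] and relations [s lgen = 0]
    for [s] in [S], and its right analogue. *)
Definition lmodule : Type := Quotient.quot lideal_of.
Definition rmodule : Type := Quotient.quot rideal_of.
HB.instance Definition _ := GRing.Zmodule.on lmodule.
HB.instance Definition _ := GRing.Zmodule.on rmodule.
HB.instance Definition _ := GRing.Zmodule_isLmodule.Build k lmodule
  (quot_scaleA lideal_ofZ) (quot_scale1 lideal_ofZ)
  (quot_scaleDr lideal_ofZ) (quot_scaleDl lideal_ofZ).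
HB.instance Definition _ := GRing.Zmodule_isLmodule.Build k rmodule
  (quot_scaleA rideal_ofZ) (quot_scale1 rideal_ofZ)
  (quot_scaleDr rideal_ofZ) (quot_scaleDl rideal_ofZ).

Definition lproj (a : A) : lmodule := \pi_(Quotient.quot lideal_of) a.
Definition rproj (a : A) : rmodule := \pi_(Quotient.quot rideal_of) a.
Definition lgen : lmodule := lproj 1.
Definition rgen : rmodule := rproj 1.
Definition lact : A -> lmodule -> lmodule :=
  locked_with quot_key
    (fun a v => lproj (a * repr (v : Quotient.quot lideal_of))).
Definition ract : rmodule -> A -> rmodule :=
  locked_with quot_key
    (fun w a => rproj (repr (w : Quotient.quot rideal_of) * a)).

Lemma lprojP a b : reflect (lproj a = lproj b) (a - b \in lideal_of).
Proof. by rewrite Quotient.idealrBE; apply: eqP. Qed.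
Lemma rprojP a b : reflect (rproj a = rproj b) (a - b \in rideal_of).
Proof. by rewrite Quotient.idealrBE; apply: eqP. Qed.

Lemma lproj_surj (P : lmodule -> Prop) : (forall a, P (lproj a)) -> forall v, P v.
Proof. by move=> Pa; elim/(@quotW _ (Quotient.quot lideal_of)) => a; apply: Pa. Qed.
Lemma rproj_surj (P : rmodule -> Prop) : (forall a, P (rproj a)) -> forall w, P w.
Proof. by move=> Pa; elim/(@quotW _ (Quotient.quot rideal_of)) => a; apply: Pa. Qed.

Lemma lact_proj a b : lact a (lproj b) = lproj (a * b).
Proof.
rewrite /lact locked_withE; apply/esym/lprojP; rewrite -mulrBr; apply: lideal_ofM.
by apply/lprojP; rewrite /lproj reprK.
Qed.
Lemma ract_proj a b : ract (rproj a) b = rproj (a * b).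
Proof.
rewrite /ract locked_withE; apply/esym/rprojP; rewrite -mulrBl; apply: rideal_ofM.
by apply/rprojP; rewrite /rproj reprK.
Qed.

Lemma lprojD a b : lproj (a + b) = lproj a + lproj b.
Proof. exact: quot_pi_add. Qed.
Lemma rprojD a b : rproj (a + b) = rproj a + rproj b.
Proof. exact: quot_pi_add. Qed.
Lemma lprojZ c a : lproj (c *: a) = c *: lproj a.
Proof. exact: (pi_quot_scale lideal_ofZ). Qed.
Lemma rprojZ c a : rproj (c *: a) = c *: rproj a.
Proof. exact: (pi_quot_scale rideal_ofZ). Qed.

Lemma lact1 v : lact 1 v = v.
Proof. by elim/lproj_surj: v => b; rewrite lact_proj mul1r. Qed.
Lemma lactA a b v : lact a (lact b v) = lact (a * b) v.
Proof. by elim/lproj_surj: v => c; rewrite !lact_proj mulrA. Qed.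
Lemma lactDl a b v : lact (a + b) v = lact a v + lact b v.
Proof. by elim/lproj_surj: v => c; rewrite !lact_proj mulrDl lprojD. Qed.
Lemma lactDr a u v : lact a (u + v) = lact a u + lact a v.
Proof.
elim/lproj_surj: u => b; elim/lproj_surj: v => c.
by rewrite -lprojD !lact_proj mulrDr lprojD.
Qed.
Lemma lactZl c a v : lact (c *: a) v = c *: lact a v.
Proof. by elim/lproj_surj: v => b; rewrite !lact_proj -quot_scalerAl lprojZ. Qed.
Lemma lactZr c a v : lact a (c *: v) = c *: lact a v.
Proof.
by elim/lproj_surj: v => b; rewrite -lprojZ !lact_proj -quot_scalerAr lprojZ.
Qed.

Lemma ract1 w : ract w 1 = w.
Proof. by elim/rproj_surj: w => b; rewrite ract_proj mulr1. Qed.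
Lemma ractA w a b : ract (ract w a) b = ract w (a * b).
Proof. by elim/rproj_surj: w => c; rewrite !ract_proj mulrA. Qed.
Lemma ractDr w a b : ract w (a + b) = ract w a + ract w b.
Proof. by elim/rproj_surj: w => c; rewrite !ract_proj mulrDr rprojD. Qed.
Lemma ractDl u w a : ract (u + w) a = ract u a + ract w a.
Proof.
elim/rproj_surj: u => b; elim/rproj_surj: w => c.
by rewrite -rprojD !ract_proj mulrDl rprojD.
Qed.
Lemma ractZr c w a : ract w (c *: a) = c *: ract w a.
Proof. by elim/rproj_surj: w => b; rewrite !ract_proj -quot_scalerAr rprojZ. Qed.
Lemma ractZl c w a : ract (c *: w) a = c *: ract w a.
Proof.
by elim/rproj_surj: w => b; rewrite -rprojZ !ract_proj -quot_scalerAl rprojZ.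
Qed.

Lemma lgenE a : lact a lgen = lproj a.
Proof. by rewrite lact_proj mulr1. Qed.
Lemma rgenE a : ract rgen a = rproj a.
Proof. by rewrite ract_proj mul1r. Qed.

Lemma lact_gen0 s : S s -> lact s lgen = 0.
Proof.
move=> Ss; rewrite lgenE.
have -> : 0 = lproj 0 by apply: (addrI (lproj 0)); rewrite -lprojD !addr0.
by apply/lprojP; rewrite subr0; apply/zspan_predP; constructor; exists 1, s; rewrite mul1r.
Qed.
Lemma ract_gen0 s : S s -> ract rgen s = 0.
Proof.
move=> Ss; rewrite rgenE.
have -> : 0 = rproj 0 by apply: (addrI (rproj 0)); rewrite -rprojD !addr0.
by apply/rprojP; rewrite subr0; apply/zspan_predP; constructor; exists s, 1; rewrite mulr1.
Qed.

End CyclicModules.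

Section Fermions.
Context (k : fieldType).

Definition free_alg : Type := {malg k[{fmonom int}]}.
HB.instance Definition _ := GRing.Lalgebra.on free_alg.

Fact free_scalerAr (c : k) (u v : free_alg) : c *: (u * v) = u * (c *: v).
Proof.
have cC (w : free_alg) : c *: w = w * malgC c.
  apply/malgP => m; rewrite -mul_malgC !malgM_def fgmulUg fgmulgU !raddf_sum /=.
  by apply: eq_bigr => d _; rewrite mul1m mulm1 mulrC.
by rewrite [LHS]cC -mulrA -cC.
Qed.
HB.instance Definition _ := GRing.Lalgebra_isAlgebra.Build k free_alg free_scalerAr.

Definition free_phi (n : int) : free_alg := mkmalgU (fmu n) 1.

Definition clifford_relations : set free_alg :=
  [set u | exists m n : int,
     u = free_phi m * free_phi n + free_phi n * free_phi m
         - (2 * (-1) ^ m * (m + n == 0)%:R : k)%:A].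

Definition fermion_alg : Type := quot_alg clifford_relations.
HB.instance Definition _ := GRing.PzRing.on fermion_alg.
HB.instance Definition _ := GRing.Lmodule.on fermion_alg.

Definition phi (n : int) : fermion_alg := quot_pi clifford_relations (free_phi n).

Lemma phi_anticomm (m n : int) :
  phi m * phi n + phi n * phi m =
  (2 * (-1) ^ m * (m + n == 0)%:R : k) *: (1 : fermion_alg).
Proof.
by apply: (quot_pi_anticomm (G := clifford_relations)); exists m, n.
Qed.

Definition fockF : Type :=
  lmodule (G := clifford_relations)
    [set a | exists2 n : int, (0 < n)%R & a = phi (- n)].
HB.instance Definition _ := GRing.Lmodule.on fockF.
Definition ket0 : fockF := lgen _.

Definition fockE : Type :=
  rmodule (G := clifford_relations)
    [set a | exists2 n : int, (0 < n)%R & a = phi n].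
HB.instance Definition _ := GRing.Lmodule.on fockE.
Definition bra0 : fockE := rgen _.

Definition opF (X : fermion_alg) (v : fockF) : fockF := lact X v.
Definition opE (w : fockE) (X : fermion_alg) : fockE := ract w X.

Definition vacuum_pairing (B : fockE -> fockF -> k) : Prop :=
  [/\ forall v, scalar (B^~ v),
      forall w, scalar (B w),
      forall w X v, B (opE w X) v = B w (opF X v),
      B bra0 ket0 = 1
    & B (opE bra0 (phi 0)) ket0 = 0].

(** Operators act on [fockE] from the right: in [f (g w)], [g] acts first. *)

(** Only odd [m] are meaningful. *)
Definition bop (m : int) (w : fockE) : fockE :=
  4^-1 *: \sum_(i \in [set: int])
            (-1) ^ i *: opE (opE w (phi (- i - m))) (phi i).

Definition op_exp (T : fockE -> fockE) (w : fockE) : fockE :=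
  \sum_(j \in [set: nat]) (j`!%:R)^-1 *: iter j T w.

Variable beta : k.

(** In the second branch [n = - j.+1], the one-variable series is in [z^-1], and
    [expcmn (ucm tt) j.+1] is its monomial of degree [j.+1]. *)
Definition phi_beta (n : int) (w : fockE) : fockE :=
  match n with
  | Posz j =>
      \sum_(m \in [set: nat])
        (('X + (beta / 2)%:P) ^+ m)`_j *: opE w (phi m%:Z)
  | Negz j =>
      let u : fps unit k := fps_var tt in
      \sum_(m \in [set m : nat | (0 < m)%N])
        ((u / (1 + fps_const (beta / 2) * u)) ^+ m) (expcmn (ucm tt) j.+1)
          *: opE w (phi (- m%:Z))
  end.

Definition bop_poly (m : nat) : {poly k} :=
  2^-1 *: (('X - (beta / 2)%:P) ^+ m - (- 'X - (beta / 2)%:P) ^+ m).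

Definition bop_beta (m : nat) (w : fockE) : fockE :=
  \sum_(l < size (bop_poly m)) (bop_poly m)`_l *: bop l%:Z w.

(** [E[[p]]]: the variable of index [n] stands for [p_(n+1)]. *)
Definition ham (f : fps nat fockE) : fps nat fockE :=
  fun a => \sum_(d \in [set d : nat * {cmonom nat} | (ucm d.1 * d.2)%M = a])
             (2 / d.1.+1%:R) *: bop_beta d.1.+1 (f d.2).

Definition exp_ham (w : fockE) : fps nat fockE :=
  fun a => \sum_(j \in [set: nat])
             (j`!%:R)^-1 *: iter j ham (fun c => w *+ (c == 1%M)) a.

Definition Theta (w : fockE) : fockE :=
  2 *: \sum_(j \in [set: nat])
         (beta ^+ j.*2.+1 / 2 ^+ j.*2.+1 / j.*2.+1%:R) *: bop (- (j.*2.+1)%:Z) w.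

End Fermions.

Section FockModel.
Context (k : fieldType).

Lemma bra0_phi (n : int) : (0 < n)%R -> opE (bra0 k) (phi k n) = 0.
Proof. by move=> n0; apply: ract_gen0; exists n. Qed.

Lemma ket0_phi (n : int) : (0 < n)%R -> opF (phi k (- n)) (ket0 k) = 0.
Proof. by move=> n0; apply: lact_gen0; exists n. Qed.

Lemma opE_anticomm (w : fockE k) (m n : int) :
  opE (opE w (phi k m)) (phi k n) + opE (opE w (phi k n)) (phi k m) =
  (2 * (-1) ^ m * (m + n == 0)%:R : k) *: w.
Proof.
rewrite -[w in RHS](ract1 w) -ractZr -[RHS]/(opE _ _).
by rewrite -(phi_anticomm k m n) /opE !ractA -ractDr.
Qed.

(** Functions on the subsets [S] of [nat]: [phi_n] toggles the membership of
    [|n|]; the pairing of [<0|X] and [Y|0>] is the value at the empty set of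
    [X Y] applied to the indicator function of the empty set. *)
Let flip (a : nat) (S : nat -> bool) : nat -> bool := fun i => S i (+) (i == a).
Let sgn (a : nat) (S : nat -> bool) : k := (-1) ^+ (\sum_(i < a) S i)%N.
Let wgt (n : int) (b : bool) : k :=
  if (0 < n)%R then b%:R else if (n < 0)%R then 2 * (-1) ^ n * (~~ b)%:R else 1.
Let op (n : int) (f : (nat -> bool) -> k) (S : nat -> bool) : k :=
  sgn `|n|%N S * wgt n (S `|n|%N) * f (flip `|n|%N S).

Let flipC a b S : flip a (flip b S) = flip b (flip a S).
Proof. by apply/funext => i; rewrite /flip addbAC. Qed.
Let flipK a S : flip a (flip a S) = S.
Proof. by apply/funext => i; rewrite /flip addbK. Qed.
Let flip_neq a b S : a != b -> flip a S b = S b.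
Proof. by move=> ab; rewrite /flip eq_sym (negPf ab) addbF. Qed.
Let flip_eq a S : flip a S a = ~~ S a.
Proof. by rewrite /flip eqxx addbT. Qed.

Let sgn_flip a b S : sgn b (flip a S) = (-1) ^+ (a < b)%N * sgn b S.
Proof.
rewrite /sgn -exprD; case: ltnP => [ab|ba]; last first.
  congr (_ ^+ _); rewrite add0n; apply: eq_bigr => i _.
  by rewrite flip_neq // neq_ltn orbC (leq_trans (ltn_ord i) ba).
rewrite (bigD1 (Ordinal ab)) //= [in RHS](bigD1 (Ordinal ab)) //= flip_eq.
rewrite (eq_bigr (fun i : 'I_b => S i : nat)) => [|i ia]; last first.
  by rewrite flip_neq // eq_sym.
by case: (S a); rewrite /= ?add0n ?addnA //= add1n exprD expr2 mulN1r opprK mul1r.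
Qed.

Let wgt_anticomm (m n : int) b : `|m|%N = `|n|%N ->
  wgt m b * wgt n (~~ b) + wgt n b * wgt m (~~ b) =
  2 * (-1) ^ m * (m + n == 0)%:R.
Proof.
rewrite /wgt; case: m n => [[|p]|p] [[|q]|q] //= => [_|_|[<-]|[<-]|_].
- by rewrite expr0z; ring.
- by case: b; rewrite /= !(mulr0, mul0r, addr0).
- rewrite NegzE subrr eqxx -exprz_inv invrN1.
  by case: b; rewrite /= !(mulr0, mul0r, addr0, add0r, mulr1, mul1r).
- rewrite NegzE addNr eqxx -exprz_inv invrN1.
  by case: b; rewrite /= !(mulr0, mul0r, addr0, add0r, mulr1, mul1r).
- by case: b; rewrite /= !(mulr0, mul0r, addr0).
Qed.

Let op_anticomm m n f S :
  op m (op n f) S + op n (op m f) S = 2 * (-1) ^ m * (m + n == 0)%:R * f S.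
Proof.
rewrite /op; have [eqmn|nemn] := eqVneq `|m|%N `|n|%N; last first.
  have -> : (m + n == 0) = false.
    by apply/negbTE; apply: contra nemn; rewrite addr_eq0 => /eqP ->; rewrite abszN.
  rewrite mulr0 mul0r !sgn_flip !flip_neq // 1?eq_sym // flipC.
  have -> : (`|m| < `|n|)%N = ~~ (`|n| < `|m|)%N.
    by rewrite -leqNgt [in RHS]leq_eqVlt (negPf nemn).
  by case: (_ < _)%N; rewrite /= ?expr0 ?expr1; ring.
have sgn2 a : sgn a S * sgn a S = 1 by rewrite /sgn -expr2 sqrr_sign.
rewrite -eqmn !sgn_flip ltnn expr0 mul1r flipK flip_eq.
rewrite !mulrA -(wgt_anticomm (S `|m|%N) eqmn) -[in RHS](mul1r (_ + _)).
by rewrite -(sgn2 `|m|%N); ring.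
Qed.

Let act (m : {fmonom int}) f := foldr op f (m : seq int).

Let act_sum (T : Type) (r : seq T) (c : T -> k) g m S :
  act m (fun S => \sum_(i <- r) c i * g i S) S = \sum_(i <- r) c i * act m (g i) S.
Proof.
rewrite /act; elim: (m : seq int) S => //= n s IHs S.
rewrite [LHS]/op IHs mulr_sumr; apply: eq_bigr => i _; rewrite /op; ring.
Qed.

Let rep (u : free_alg k) f S : k := mmap idfun (fun m => act m f S) u.

Let repD (u v : free_alg k) f S : rep (u + v) f S = rep u f S + rep v f S.
Proof. exact: raddfD. Qed.
Let repB (u v : free_alg k) f S : rep (u - v) f S = rep u f S - rep v f S.
Proof. exact: raddfB. Qed.
Let repZ c (u : free_alg k) f S : rep (c *: u) f S = c * rep u f S.
Proof.
rewrite /rep (mmapEw (d := msupp u)) ?msuppZ_le // mulr_sumr.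
by apply: eq_bigr => m _; rewrite /= mcoeffZ mulrA.
Qed.

Let repM (u v : free_alg k) f S : rep (u * v) f S = rep u (rep v f) S.
Proof.
rewrite /rep malgME raddf_sum mmapE; apply: eq_bigr => a _.
rewrite raddf_sum /= act_sum mulr_sumr; apply: eq_bigr => b _.
by rewrite mmapU /= mulrA /act fmM foldr_cat.
Qed.

Let rep1 f S : rep (1 : free_alg k) f S = f S.
Proof. by rewrite /rep mmapU /= mul1r /act fm1. Qed.

Let rep_phi n f S : rep (free_phi k n) f S = op n f S.
Proof. by rewrite /rep mmapU /= mul1r /act fmU. Qed.

Let rep0r u S : rep u (fun=> 0) S = 0.
Proof.
rewrite /rep mmapE big1 // => m _; rewrite /act.
suff -> : foldr op (fun=> 0) m S = 0 by rewrite mulr0.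
by elim: (m : seq int) S => //= n s IHs S; rewrite /op IHs mulr0.
Qed.

Let ground (S : nat -> bool) : k := (`[< S = xpred0 >])%:R.
Let vev (u : free_alg k) : k := rep u ground xpred0.

Let rep_anticomm (u v : free_alg k) (c : k) f S :
  rep (u * v + v * u - c%:A) f S = rep u (rep v f) S + rep v (rep u f) S - c * f S.
Proof. by rewrite repB repZ rep1 repD (repM u v) (repM v u). Qed.

Let rep_rel r f S : clifford_relations r -> rep r f S = 0.
Proof.
move=> [m [n ->]]; rewrite rep_anticomm.
have repE p g : rep (free_phi k p) g = op p g by apply/funext => ?; exact: rep_phi.
by rewrite !repE op_anticomm subrr.
Qed.

Let vev_ideal u : u \in ideal_of (clifford_relations (k := k)) -> vev u = 0.
Proof.
move=> /zspan_predP; elim=> [v [x [r [y [rr ->]]]]||v w _ IHv _ IHw].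
- rewrite /vev repM; have -> : rep (x * r) (rep y ground) xpred0 = 0; last by [].
  rewrite repM; have -> : rep r (rep y ground) = fun=> 0; last exact: rep0r.
  by apply/funext => S; apply: rep_rel.
- exact: raddf0.
- by rewrite /vev repB -/(vev _) IHv -/(vev _) IHw subrr.
Qed.

Local Notation A := (quot_alg (clifford_relations (k := k))).
Local Notation pr := (quot_pi (clifford_relations (k := k))).
Let vevA (a : A) : k := vev (repr a).

Let vevAE u : vevA (pr u) = vev u.
Proof.
apply/esym/eqP; rewrite -subr_eq0 /vevA /vev -repB; apply/eqP/vev_ideal.
exact: quot_pi_repr.
Qed.

Let vevA_is_scalar : scalar vevA.
Proof.
move=> c; elim/quot_pi_surj => u; elim/quot_pi_surj => v.
by rewrite -quot_piZ -quot_piD !vevAE /vev repD repZ.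
Qed.

Let vevA_phil (n : int) a : (0 < n)%R -> vevA (pr (free_phi k n) * a) = 0.
Proof.
case: n => // -[//|p] _; elim/quot_pi_surj: a => u.
by rewrite -quot_piM vevAE /vev repM rep_phi /op /wgt /= mulr0 mul0r.
Qed.

Let vevA_phir (n : int) a : (0 < n)%R -> vevA (a * pr (free_phi k (- n))) = 0.
Proof.
case: n => // -[//|p] _; elim/quot_pi_surj: a => u.
rewrite -quot_piM vevAE /vev repM.
have -> : rep (free_phi k (- p.+1%:Z)) ground = fun=> 0; last exact: rep0r.
apply/funext => S; rewrite rep_phi /op /= /ground /wgt /=.
case: asboolP => [eS|_]; last by rewrite mulr0.
have := congr1 (fun f => f p.+1) eS; rewrite flip_eq => /negbFE ->.
by rewrite !mulr0 mul0r.
Qed.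

Let lP := [set a : A | exists2 n : int, (0 < n)%R & a = phi k (- n)].
Let rP := [set a : A | exists2 n : int, (0 < n)%R & a = phi k n].

Let bracket (w : fockE k) (v : fockF k) : k :=
  vevA (repr (w : Quotient.quot (rideal_of rP)) * repr (v : Quotient.quot (lideal_of lP))).

Let vevAD a b : vevA (a + b) = vevA a + vevA b.
Proof. by have := vevA_is_scalar 1 a b; rewrite scale1r mul1r. Qed.
Let vevA0 : vevA 0 = 0.
Proof. by apply: (addrI (vevA 0)); rewrite -vevAD !addr0. Qed.
Let vevAB a b : vevA (a - b) = vevA a - vevA b.
Proof. by apply: (addIr (vevA b)); rewrite -vevAD !subrK. Qed.
Let vevAZ c a : vevA (c *: a) = c * vevA a.
Proof. by have := vevA_is_scalar c a 0; rewrite addr0 vevA0 addr0. Qed.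

Let vevA_rideal u b : u \in rideal_of rP -> vevA (u * b) = 0.
Proof.
move=> /zspan_predP; elim=> [v [s [a [[n n0 ->] ->]]]||v w _ IHv _ IHw].
- by rewrite -mulrA; apply: vevA_phil.
- by rewrite mul0r.
- by rewrite mulrBl vevAB IHv IHw subrr.
Qed.

Let vevA_lideal u b : u \in lideal_of lP -> vevA (b * u) = 0.
Proof.
move=> /zspan_predP; elim=> [v [a [s [[n n0 ->] ->]]]||v w _ IHv _ IHw].
- by rewrite mulrA; apply: vevA_phir.
- by rewrite mulr0.
- by rewrite mulrBr vevAB IHv IHw subrr.
Qed.

Let bracketE a b : bracket (rproj rP a) (lproj lP b) = vevA (a * b).
Proof.
rewrite /bracket.
set a' := repr (rproj rP a : Quotient.quot _).
set b' := repr (lproj lP b : Quotient.quot _).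
have Ja : a - a' \in rideal_of rP by apply/rprojP; rewrite /rproj reprK.
have Jb : b - b' \in lideal_of lP by apply/lprojP; rewrite /lproj reprK.
have -> : a * b = (a - a') * b + a' * (b - b') + a' * b'.
  by rewrite mulrBl mulrBr addrA subrK subrK.
by rewrite (vevAD (_ + _)) (vevAD (_ * b)) (vevA_rideal b Ja) (vevA_lideal a' Jb) !add0r.
Qed.

Lemma vacuum_pairing_exists : exists B : fockE k -> fockF k -> k, vacuum_pairing B.
Proof.
exists bracket; split.
- elim/lproj_surj => b c; elim/rproj_surj => u; elim/rproj_surj => w.
  rewrite -rprojZ -rprojD !bracketE mulrDl -quot_scalerAl vevAD vevAZ //.
- elim/rproj_surj => a c; elim/lproj_surj => u; elim/lproj_surj => w.
  rewrite -lprojZ -lprojD !bracketE mulrDr -quot_scalerAr vevAD vevAZ //.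
- elim/rproj_surj => a X; elim/lproj_surj => b.
  by rewrite /opE /opF ract_proj lact_proj !bracketE mulrA.
- by rewrite bracketE mulr1 -quot_pi1 vevAE /vev rep1 /ground asboolT.
- rewrite /opE /bra0 rgenE bracketE mulr1 vevAE /vev rep_phi /op /ground.
  rewrite asboolF ?mulr0 // => /(congr1 (fun f => f 0%N)).
  by rewrite flip_eq.
Qed.

End FockModel.

Section GQ.
Context (k : fieldType) (beta : k).

(** The variable of index [i] stands for [x_(i+1)]; the coefficients are
    polynomials in [z], written ['X]. *)
Definition GQ_factor (i : nat) : fps nat {poly k} :=
  let x : fps nat {poly k} := fps_var i in
  let xbar := - x / (1 + fps_const beta%:P * x) in
  let zb := fps_const ('X + beta%:P) in
  (1 + zb * x) / (1 + zb * xbar).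

(** The coefficient of [z^n] in [(\sum_j (-beta)^j z^-j) * P(z)], for every
    coefficient [P] of the infinite product. *)
Definition GQ (n : int) : fps nat k :=
  fun c => \sum_(d \in [set d : nat * nat | d.2%:Z - d.1%:Z = n])
             (- beta) ^+ d.1 * (fps_infprod GQ_factor c)`_d.2.

Definition power_sum (m : nat) : fps nat k :=
  fun c => \sum_(i \in [set: nat]) (fps_var i ^+ m : fps nat k) c.

Definition at_power_sums (f : fps nat k) : fps nat k :=
  fun c => \sum_(a \in [set: {cmonom nat}])
             f a * (\prod_(i <- finsupp a) power_sum i.+1 ^+ a i) c.

End GQ.

Definition Qbeta : fieldType := {fraction {poly rat}}.
Definition beta : Qbeta := tofrac 'X.

(* Main.v *)
(** Conjugation by [e^Theta] turns [phi(z) (1 + beta/z)] into [phi(z)], where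
    [phi(z)] generates the [phi_n^(beta)].  As [phi_j^(beta)|0> = 0] for [j < 0],
    inserting [phi_0^(beta) e^Theta] in front of [|0>] therefore replaces a
    polynomial factor [P(w)] of that field by the scalar [P(-beta)]; in particular
    the functional [<.| phi_0^(beta) e^Theta |0>] vanishes on [<v| b_l], [l] odd
    positive.  Moving the [b_l] of the Hamiltonian to the right, each
    [(2/n) b_n^(beta)] becomes [h_n = (z^n - (-z-beta)^n - (-beta)^n)/n], and the
    remaining two-point function is [1/(1 + beta/z)].  What is left is the identity
    [exp (sum_n h_n p_n(x)) = prod_i (1+(z+beta)x_i)/(1+(z+beta)xbar_i)]: both sides
    have the same logarithmic derivative under each [x_i d/dx_i], and this determines
    all coefficients from the constant one. *)From Pilot Require Import Defs.
From HB Require Import structures.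
From mathcomp Require Import all_boot all_order all_algebra.
From mathcomp Require Import finmap monalg zify ring.
From mathcomp Require Import boolp classical_sets functions cardinality fsbigop.

Set Implicit Arguments.
Unset Strict Implicit.
Unset Printing Implicit Defensive.

Import Order.TTheory GRing.Theory Num.Theory.
Local Open Scope ring_scope.

(** Origin of the factor: put [c = beta/2]. The coefficients of [Theta] are those of
    [log ((1 + ct)/(1 - ct))], so conjugation by [e^Theta] relates the undeformed field [phi(x)] to
    itself through [(1 - c/x)/(1 + c/x)]. The deformed field is [phi(z + c)], and at [x = z + c]
    this ratio is [z/(z + beta)]. Origin of [h_n]: moving [b_l] past the deformed field gives
    [(z + c)^l], and past the adjacent [e^Theta] gives [c^l]. Substituting [X = z + c] and [X = c]
    in the polynomial of [b_n^(beta)] produces the three powers. The obstacle is finiteness. The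
    operators are sums over all integers, and such a sum is 0 by convention when its support is
    infinite, so no rearrangement is free. Instead of a basis of the Fock space, a degree bound
    [vanish N w] is carried along; every vector has one because [E] is generated by [<0|]. Under
    such a bound each sum lives on a finite window, chosen large enough for all the vectors
    compared. The central term in the commutator of two currents is then a boundary term of the
    window. *)

Lemma fsbigT_seq (V : nmodType) (T : choiceType) (r : seq T) (F : T -> V) :
    uniq r -> (forall i, i \notin r -> F i = 0) ->
  \sum_(i \in [set: T]) F i = \sum_(i <- r) F i.
Proof.
move=> ur rF; rewrite (fsbigE r) //; last by move=> i _; apply: rF.
by apply: eq_bigl => i; rewrite in_setT.
Qed.

Lemma fsbigT_nat (V : nmodType) (N : nat) (F : nat -> V) :
    (forall i, (N <= i)%N -> F i = 0) ->
  \sum_(i \in [set: nat]) F i = \sum_(i < N) F i.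
Proof.
move=> NF; rewrite (@fsbigT_seq _ _ (iota 0 N)) ?iota_uniq //; last first.
  by move=> i; rewrite mem_iota /= add0n -leqNgt; apply: NF.
by rewrite -[X in iota _ X]subn0 -/(index_iota 0 N) big_mkord.
Qed.

(** The window from [-K] to [K - 1]. Different sums are cut to one common window, so that they can
    be compared term by term. *)
Definition zrange (K : nat) : seq int := [seq i%:Z - K%:Z | i <- iota 0 (K + K)].

Lemma zrange_uniq K : uniq (zrange K).
Proof. by rewrite map_inj_uniq ?iota_uniq // => i j /addIr []. Qed.

Lemma mem_zrange K (i : int) : (i \in zrange K) = (- K%:Z <= i < K%:Z).
Proof.
apply/mapP/idP => [[j]|iK]; first by rewrite mem_iota => jK ->; lia.
by exists (absz (i + K%:Z)); [rewrite mem_iota|]; lia.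
Qed.

Lemma fsbigT_int (V : nmodType) (K : nat) (F : int -> V) :
    (forall i, (i < - K%:Z) || (K%:Z <= i) -> F i = 0) ->
  \sum_(i \in [set: int]) F i = \sum_(i <- zrange K) F i.
Proof.
move=> KF; apply: fsbigT_seq => [|i]; first exact: zrange_uniq.
by rewrite mem_zrange => iK; apply: KF; lia.
Qed.

Lemma fsbigT_intB (V : nmodType) (s : int) (F : int -> V) :
  \sum_(i \in [set: int]) F (i - s) = \sum_(i \in [set: int]) F i.
Proof.
rewrite [RHS](reindex_fsbigT (fun i => i - s)) //.
by exists (fun i => i + s) => i; rewrite ?subrK ?addrK.
Qed.

Section LinearFun.
Context (k : pzRingType) (U V : lmodType k) (f : U -> V) (lf : linear f).

(** Linearity is a hypothesis rather than a structure, because for the operators below it is itself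
    the result of a finiteness argument, and for [bop m] it is established under [m != 0]. *)
Lemma lin0 : f 0 = 0.
Proof. by have := lf (-1) 0 0; rewrite scaleN1r oppr0 addr0 scaleN1r addNr. Qed.

Lemma linD u v : f (u + v) = f u + f v.
Proof. by have := lf 1 u v; rewrite !scale1r. Qed.

Lemma linZ c u : f (c *: u) = c *: f u.
Proof. by have := lf c u 0; rewrite !addr0 lin0 addr0. Qed.

Lemma linB u v : f (u - v) = f u - f v.
Proof. by rewrite -scaleN1r linD linZ scaleN1r. Qed.

Lemma lin_sum (T : Type) (r : seq T) (P : pred T) (F : T -> U) :
  f (\sum_(i <- r | P i) F i) = \sum_(i <- r | P i) f (F i).
Proof. exact: (big_morph f linD lin0). Qed.
End LinearFun.

(** * The graded Fock space *)

Section Words.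
Context (k : fieldType).
Local Notation E := (fockE k).
Implicit Types (w : E) (s : seq int) (n : int).

Definition rphi w n : E := opE w (phi k n).
Definition word w s : E := foldl rphi w s.

Lemma rphi_linear n : linear (fun w => rphi w n).
Proof. by move=> c u v; rewrite /rphi /opE ractDl ractZl. Qed.

Lemma rphi0 n : rphi 0 n = 0. Proof. exact: (lin0 (rphi_linear n)). Qed.
Lemma rphiD u w n : rphi (u + w) n = rphi u n + rphi w n.
Proof. exact: (linD (rphi_linear n)). Qed.
Lemma rphiZ c w n : rphi (c *: w) n = c *: rphi w n.
Proof. exact: (linZ (rphi_linear n)). Qed.
Lemma rphi_sum T (r : seq T) (P : pred T) (F : T -> E) n :
  rphi (\sum_(i <- r | P i) F i) n = \sum_(i <- r | P i) rphi (F i) n.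
Proof. exact: (lin_sum (rphi_linear n)). Qed.

Lemma rphiC w m n :
  rphi (rphi w m) n = (2 * (-1) ^ m * (m + n == 0)%:R) *: w - rphi (rphi w n) m.
Proof. by rewrite -opE_anticomm addrK. Qed.

Lemma word_linear s : linear (fun w => word w s).
Proof.
rewrite /word; elim: s => [|n s IHs] c u v //=.
by rewrite (rphi_linear n) IHs.
Qed.

Lemma word_cons w n s : word w (n :: s) = word (rphi w n) s. Proof. by []. Qed.

Lemma word_cat w s t : word w (s ++ t) = word (word w s) t.
Proof. exact: foldl_cat. Qed.

(** Some letter [n] is positive; it is moved to the left end, where [<0|] kills it. Passing a letter
    [m] leaves a contraction only if [m + n = 0]; the contracted word is shorter by two letters and
    has the same total index, so the induction on the length applies. *)
Lemma word_bra0 s : 0 < \sum_(i <- s) i -> word (bra0 k) s = 0.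
Proof.
have [N] := ubnP (size s); elim: N s => // N IHN s; rewrite ltnS => sN s0.
have /hasP[n ns n0] : has (fun n => 0 < n) s.
  apply: contraLR s0 => /hasPn s_le0; rewrite -leNgt big_seq.
  by apply: sumr_le0 => i /s_le0; rewrite -leNgt.
case/splitPr: ns sN s0 => s1 s2.
elim/last_ind: s1 s2 => [|s1 m IHs] s2 sN s0.
  by rewrite /word /= /rphi bra0_phi // -[foldl _ _ _]/(word 0 s2) (lin0 (word_linear s2)).
have perm_mn : perm_eq (s1 ++ n :: m :: s2) (rcons s1 m ++ n :: s2).
  by rewrite cat_rcons perm_cat2l (perm_catCA [:: n] [:: m]).
have := IHs (m :: s2); rewrite (perm_size perm_mn) (perm_big _ perm_mn) /= => /(_ sN s0).
rewrite cat_rcons !word_cat !word_cons => nm0.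
rewrite (rphiC _ m n) (linB (word_linear _)) nm0 subr0 (linZ (word_linear _)).
have [mn0|_] := eqVneq (m + n) 0; last by rewrite mulr0 scale0r.
rewrite -word_cat IHN ?scaler0 //.
  by move: sN; rewrite !size_cat size_rcons /=; lia.
by move: s0; rewrite cat_rcons !big_cat !big_cons /= (addrA m) mn0 add0r.
Qed.

(** Encodes the grading: every component of [w] has degree at most [N], where
    [phi_n] lowers the degree by [n] and the degrees are nonnegative. *)
Definition vanish (N : int) w := forall s, N < \sum_(i <- s) i -> word w s = 0.

Lemma vanishW N M w : N <= M -> vanish N w -> vanish M w.
Proof. by move=> NM wN s Ms; apply: wN; apply: le_lt_trans Ms. Qed.

Lemma vanish_rphi N w n : vanish N w -> vanish (N - n) (rphi w n).
Proof.
by move=> wN s Ns; apply: (wN (n :: s)); rewrite big_cons addrC -ltrBlDr.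
Qed.

Lemma vanish_lt0 N w : N < 0 -> vanish N w -> w = 0.
Proof. by move=> N0 /(_ [::]); rewrite big_nil; apply. Qed.

Lemma vanish_rphi0 N w n : vanish N w -> N < n -> rphi w n = 0.
Proof. by move=> /(_ [:: n]); rewrite big_seq1; apply. Qed.

Lemma vanish0 N : vanish N 0.
Proof. by move=> s _; rewrite (lin0 (word_linear s)). Qed.

Lemma vanishD N u w : vanish N u -> vanish N w -> vanish N (u + w).
Proof. by move=> uN wN s Ns; rewrite (linD (word_linear s)) uN // wN // addr0. Qed.

Lemma vanishZ N c w : vanish N w -> vanish N (c *: w).
Proof. by move=> wN s Ns; rewrite (linZ (word_linear s)) wN // scaler0. Qed.

Lemma vanish_sum N T (r : seq T) (P : pred T) (F : T -> E) :
  (forall i, P i -> vanish N (F i)) -> vanish N (\sum_(i <- r | P i) F i).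
Proof.
by move=> FN; apply: big_ind FN => [|u w]; [apply: vanish0|apply: vanishD].
Qed.

Lemma vanish_bra0 : vanish 0 (bra0 k).
Proof. exact: word_bra0. Qed.

(** A vector is the class of an element of the free algebra, and the finite support of that element
    lists the words. *)
Lemma bra0_cyclic w : exists (r : seq (k * seq int)),
  w = \sum_(p <- r) p.1 *: word (bra0 k) p.2.
Proof.
elim/rproj_surj: w; elim/quot_pi_surj => u; rewrite -rgenE -/(bra0 k).
exists [seq (mcoeff m u, m : seq int) | m <- msupp u]; rewrite big_map.
pose f (v : free_alg k) : E := ract (bra0 k) (quot_pi _ v).
have lf : linear f by move=> c v v'; rewrite /f quot_piD quot_piZ ractDr ractZr.
rewrite -[LHS]/(f u) [in LHS](monalgE u) (lin_sum lf); apply: eq_bigr => m _ /=.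
have -> : mkmalgU m (mcoeff m u) = mcoeff m u *: mkmalgU m 1 :> free_alg k.
  by apply/malgP => d; rewrite mcoeffZ !mcoeffU mulr_natr.
rewrite (linZ lf); congr (_ *: _); rewrite /f -[m in LHS]fmK.
(* The right action appends letters at the end of a word, hence the induction on [rcons]. *)
elim/last_ind: (m : seq int) => [|s n IHs].
  by rewrite -fmoneE -[mkmalgU _ _]/(1 : free_alg k) quot_pi1 ract1.
have -> : mkmalgU (FMonom (rcons s n)) 1 = mkmalgU (FMonom s) 1 * free_phi k n :> free_alg k.
  rewrite /free_phi malgM_def fgmulUU mulr1; congr (mkmalgU _ _).
  by apply/eqP; rewrite fmP fmM fmU cats1.
by rewrite quot_piM -ractA IHs -cats1 word_cat.
Qed.

(** This makes the infinite sums of modes finite on each vector. For a word the bound is the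
    absolute value of its total index, by [word_bra0] applied to concatenations. *)
Lemma vanish_exists w : exists N : nat, vanish N%:Z w.
Proof.
have [r ->] := bra0_cyclic w.
suff [N NP] : exists N : nat, forall p, p \in r -> vanish N%:Z (word (bra0 k) p.2).
  by exists N; rewrite big_seq; apply: vanish_sum => p /NP; apply: vanishZ.
elim: r => [|p r [N IHr]]; first by exists 0%N.
exists (maxn N (absz (\sum_(i <- p.2) i))) => q; rewrite inE => /predU1P[->|/IHr qN].
  move=> s ss; rewrite -word_cat; apply: word_bra0; rewrite big_cat /=.
  by move: (\sum_(i <- p.2) i) (\sum_(i <- s) i) ss => x y; lia.
by apply: vanishW qN; lia.
Qed.

End Words.

Section SignZ.
Context (k : fieldType).
Implicit Types m n : int.

Lemma signzD m n : (-1 : k) ^ (m + n) = (-1) ^ m * (-1) ^ n.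
Proof. by rewrite expfzDr // oppr_eq0 oner_eq0. Qed.

Lemma signzN m : (-1 : k) ^ (- m) = (-1) ^ m.
Proof. by rewrite -exprz_inv invrN1. Qed.

Lemma signz_sq m : (-1 : k) ^ m * (-1) ^ m = 1.
Proof. by rewrite -{2}signzN -signzD subrr. Qed.

Lemma signz_odd m : odd (absz m) -> (-1 : k) ^ m = -1.
Proof.
case: m => n on; first by rewrite -exprnP -signr_odd on.
by rewrite NegzE signzN -exprnP -signr_odd on.
Qed.
End SignZ.

(** * The currents [b_m]: finiteness and commutator with [phi_n] *)

Section CurrentOperators.
Context (k : fieldType).
Local Notation E := (fockE k).
Implicit Types (w : E) (m n i : int).

Definition quad w m i : E := (-1) ^ i *: rphi (rphi w (- i - m)) i.

Lemma bop_quad m w : bop m w = 4^-1 *: \sum_(i \in [set: int]) quad w m i.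
Proof. by []. Qed.

Lemma quad_linear m i : linear (fun w => quad w m i).
Proof.
by move=> c u v; rewrite /quad !rphiD !rphiZ scalerDr !scalerA mulrC.
Qed.

(** Away from [m + n = 0] the two modes anticommute, so [phi_n] may act first and kill [w]. This
    bounds the quadratic terms of [bop m] from above for [m != 0]; for [m = 0] they do not die
    out. *)
Lemma rphi2_eq0 N w m n :
  vanish N w -> N < n -> m + n != 0 -> rphi (rphi w m) n = 0.
Proof.
move=> wN Nn /negPf mn; rewrite rphiC mn mulr0 scale0r sub0r.
by rewrite (vanish_rphi0 wN Nn) rphi0 oppr0.
Qed.

Lemma quad_high N w m i : m != 0 -> vanish N w -> N < i -> quad w m i = 0.
Proof.
move=> m0 wN Ni; rewrite /quad (rphi2_eq0 wN) ?scaler0 //.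
by apply: contra m0; lia.
Qed.

Lemma quad_low N w m i : vanish N w -> N < - i - m -> quad w m i = 0.
Proof. by move=> wN Ni; rewrite /quad (vanish_rphi0 wN) // rphi0 scaler0. Qed.

Lemma bopE (N K : nat) m w : m != 0 -> vanish N w -> (N + absz m < K)%N ->
  bop m w = 4^-1 *: \sum_(i <- zrange K) quad w m i.
Proof.
move=> m0 wN NK; rewrite bop_quad (@fsbigT_int _ K) // => i /orP[iK|Ki].
  by apply: (quad_low wN); lia.
by apply: (quad_high m0 wN); lia.
Qed.

Lemma bop_linear m : m != 0 -> linear (bop (k := k) m).
Proof.
move=> m0 c u v; have [N uN] := vanish_exists u; have [M vM] := vanish_exists v.
pose L := maxn N M; have uL : vanish L u by apply: vanishW uN; lia.
have vL : vanish L v by apply: vanishW vM; lia.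
have wL : vanish L (c *: u + v) by apply: vanishD => //; apply: vanishZ.
rewrite !(@bopE L (L + absz m).+1) // scalerA mulrC -scalerA -scalerDr.
rewrite [c *: \sum_(_ <- _) _]scaler_sumr.
by rewrite -big_split /=; congr (_ *: _); apply: eq_bigr => i _; rewrite (quad_linear m i).
Qed.

Lemma vanish_bop (N : int) m w : m != 0 -> vanish N w -> vanish (N + m) (bop m w).
Proof.
move=> m0 wN; have wN' : vanish (absz N) w by apply: vanishW wN; lia.
rewrite (bopE m0 wN' (ltnSn _)); apply/vanishZ/vanish_sum => i _.
apply: vanishZ; have := vanish_rphi (n := i) (vanish_rphi (n := - i - m) wN).
by apply: vanishW; lia.
Qed.

Lemma rphi3C w a b n :
  rphi (rphi (rphi w n) a) b = rphi (rphi (rphi w a) b) n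
    + (2 * (-1) ^ n * (n + a == 0)%:R) *: rphi w b
    - (2 * (-1) ^ n * (n + b == 0)%:R) *: rphi w a.
Proof.
rewrite (rphiC w n a) (linB (rphi_linear b)).
by rewrite rphiZ (rphiC (rphi w a) n b) opprB addrCA addrA.
Qed.

(** Commuting [phi_n] with the quadratic terms leaves two contractions, at [i = n - m] and
    [i = - n]. For odd [m] each is [-2 phi_(n-m)], and the prefactor 1/4 turns their sum into
    [- phi_(n-m)]; for even [m] they would cancel. *)
Lemma bop_rphi m w n : 4 != 0 :> k -> odd (absz m) ->
  bop m (rphi w n) = rphi (bop m w) n - rphi w (n - m).
Proof.
move=> k4 om; have m0 : m != 0 by lia.
have [N wN] := vanish_exists w.
have wnN : vanish (N + absz n)%N (rphi w n).
  by apply: (vanishW _ (vanish_rphi (n := n) wN)); lia.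
(* One window for both [w] and [w phi_n], which also contains the two contraction indices. *)
pose K := (N + absz n + absz m).+1.
rewrite (@bopE _ K _ _ m0 wnN) ?(@bopE _ K _ _ m0 wN); [|lia..].
rewrite rphiZ rphi_sum; pose d i : E :=
  (2 * (-1) ^ (n + i) * (n + (- i - m) == 0)%:R) *: rphi w i
    - (2 * (-1) ^ (n + i) * (n + i == 0)%:R) *: rphi w (- i - m).
transitivity (4^-1 *: \sum_(i <- zrange K) (rphi (quad w m i) n + d i)).
  congr (_ *: _); apply: eq_bigr => i _; rewrite /quad /d rphi3C.
  rewrite -addrA scalerDr rphiZ scalerBr !scalerA; congr (_ + (_ *: _ - _ *: _)).
    by rewrite signzD; ring.
  by rewrite signzD; ring.
rewrite big_split scalerDr; congr (_ + _); rewrite sumrB.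
rewrite (bigD1_seq (n - m)) ?zrange_uniq ?mem_zrange //=; last lia.
rewrite [X in _ + X - _]big1 => [|i inm]; last first.
  by rewrite (_ : (_ == 0) = false) ?mulr0 ?scale0r //; lia.
rewrite (bigD1_seq (- n)) ?zrange_uniq ?mem_zrange //=; last lia.
rewrite [X in _ - (_ + X)]big1 => [|i inm]; last first.
  by rewrite (_ : (_ == 0) = false) ?mulr0 ?scale0r //; lia.
rewrite !addr0 opprK (_ : n + (- (n - m) - m) = 0); last by ring.
rewrite addrN !eqxx !mulr1 -scalerBl scalerA addrA.
have -> : (-1 : k) ^ (n + n - m) = -1.
  by rewrite signzD signzN signzD signz_sq mul1r signz_odd.
by rewrite (_ : 4^-1 * _ = -1) ?scaleN1r //; field.
Qed.
End CurrentOperators.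

Lemma sum_zrange (V : nmodType) (K : nat) (F : int -> V) :
  \sum_(i <- zrange K) F i = \sum_(0 <= i < K + K) F (i%:Z - K%:Z).
Proof. by rewrite big_map /index_iota subn0. Qed.

(** The shift by [m] leaves the last [m] values of [u] uncancelled. This boundary term is the source
    of the central term in [bop_heisenberg]. *)
Lemma telescope_zrange (V : zmodType) (K m : nat) (u : int -> V) (v : V) :
    (m <= K + K)%N -> (forall i : int, i < - K%:Z -> u i = 0) ->
    (forall i : int, K%:Z - m%:Z <= i -> u i = v) ->
  \sum_(i <- zrange K) (u i - u (i - m%:Z)) = v *+ m.
Proof.
move=> mK u0 uv; rewrite sumrB !sum_zrange.
rewrite (@big_cat_nat _ _ _ (K + K - m)%N) ?leq_subr //=.
rewrite [X in _ - X](@big_cat_nat _ _ _ m) //=.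
rewrite [X in _ - (X + _)]big_nat_cond [X in _ - (X + _)]big1 ?add0r; last first.
  by move=> i ?; apply: u0; lia.
have -> : \sum_(m <= i < K + K) u (i%:Z - K%:Z - m%:Z) =
          \sum_(0 <= i < K + K - m) u (i%:Z - K%:Z).
  by rewrite -{1}[m]add0n big_addn; apply: eq_bigr => i _; congr u; lia.
rewrite addrAC subrr add0r big_nat_cond (eq_bigr (fun=> v)) => [|i ?]; last first.
  by apply: uv; lia.
by rewrite -big_nat_cond big_const_nat iter_addr_0 subKn.
Qed.

(** * The Heisenberg relation and the commutators of [Theta] *)

Section Theta.
Context (k : fieldType) (char0 : [pchar k] =i pred0) (beta : k).
Local Notation E := (fockE k).
Implicit Types (w : E).

Lemma natr_neq0 n : n.+1%:R != 0 :> k.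
Proof. by have /pcharf0P -> := char0. Qed.

(** Commuting [b_m] with each quadratic term of [b_(-l)] gives [u i - u (i - m)], where [u] are the
    quadratic terms of index [m - l]. For large [i] these are 0 if [l != m], but [2 w] if [l = m];
    telescoping then leaves [m] copies of [2 w], times 1/4. *)
Lemma bop_heisenberg (l m : nat) w : odd l -> odd m ->
  bop (- l%:Z) (bop m%:Z w) = bop m%:Z (bop (- l%:Z) w) + (m%:R / 2 * (l == m)%:R) *: w.
Proof.
move=> ol om; have [m0 l0] : m%:Z != 0 /\ - l%:Z != 0 by split; lia.
have [N wN] := vanish_exists w.
have bwN : vanish (N + m)%N (bop m%:Z w) by rewrite PoszD; apply: vanish_bop.
have k4 := natr_neq0 3; have lb := bop_linear (k := k) m0.
pose K := (N + m + m + l).+1; pose u := quad w (m%:Z - l%:Z).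
rewrite (@bopE _ _ K _ _ l0 bwN) ?(@bopE _ _ K _ _ l0 wN); [|lia..].
rewrite (linZ lb) (lin_sum lb).
have rphi_bop (v : E) (n : int) :
    rphi (bop m%:Z v) n = bop m%:Z (rphi v n) + rphi v (n - m%:Z).
  by rewrite bop_rphi ?subrK.
transitivity (4^-1 *: \sum_(i <- zrange K)
    (bop m%:Z (quad w (- l%:Z) i) + (u i - u (i - m%:Z)))).
  congr (_ *: _); apply: eq_bigr => i _; rewrite /u /quad.
  rewrite rphi_bop rphiD rphi_bop (linZ lb) !scalerDr -addrA; congr (_ + _).
  rewrite addrC; congr (_ *: rphi (rphi w _) i + _); first by lia.
  rewrite signzD signzN (@signz_odd k m%:Z) // mulrN1 scaleNr [RHS]opprK.
  by congr (_ *: rphi (rphi w _) _); lia.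
rewrite big_split scalerDr; congr (_ + _).
rewrite (@telescope_zrange _ _ _ _ ((2 * (l == m)%:R) *: w)).
- rewrite -scaler_nat !scalerA; congr (_ *: _); have := natr_neq0 1.
  by move=> k2; field; rewrite k2 k4.
- lia.
- by move=> i iK; apply: (quad_low wN); lia.
- move=> i Ki; rewrite /u /quad rphiC (vanish_rphi0 (n := i) wN) ?rphi0 ?subr0; last by lia.
  rewrite scalerA; congr (_ *: _).
  have [->|lm] := eqVneq l m.
    by rewrite (_ : _ == 0) ?subrr ?subr0 ?signzN ?mulr1 1?mulrCA ?signz_sq ?mulr1 //; lia.
  by rewrite (_ : (_ == 0) = false) ?mulr0 //; lia.
Qed.

(** The coefficient of [t^(2j+1)] in [log ((1 + ct)/(1 - ct))], with [c = beta/2]. *)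
Definition theta j : k := 2 * ((beta / 2) ^+ j.*2.+1 / j.*2.+1%:R).

(** [b_(-2j-1)] lowers the degree by [2j + 1], hence kills [w] once [2j + 1 > N]. *)
Lemma ThetaE (N M : nat) w : vanish N w -> (N <= M)%N ->
  Theta beta w = \sum_(j < M) theta j *: bop (- j.*2.+1%:Z) w.
Proof.
move=> wN NM; rewrite /Theta (@fsbigT_nat _ M).
  rewrite scaler_sumr; apply: eq_bigr => j _.
  by rewrite scalerA /theta expr_div_n.
move=> j Mj; rewrite (@vanish_lt0 _ (N%:Z - j.*2.+1%:Z) (bop _ w)) ?scaler0 //.
  by lia.
by apply: vanish_bop wN; lia.
Qed.

Lemma Theta_linear : linear (Theta beta).
Proof.
move=> c u v; have [N uN] := vanish_exists u; have [M vM] := vanish_exists v.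
pose L := maxn N M; have uL : vanish L u by apply: vanishW uN; lia.
have vL : vanish L v by apply: vanishW vM; lia.
have wL : vanish L (c *: u + v) by apply: vanishD => //; apply: vanishZ.
rewrite !(@ThetaE L L) // scaler_sumr -big_split /=; apply: eq_bigr => j _.
have nz : - j.*2.+1%:Z != 0 by lia.
by rewrite (bop_linear nz) scalerDr !scalerA [theta j * c]mulrC.
Qed.

Lemma vanish_Theta (N : int) w : vanish N w -> vanish (N - 1) (Theta beta w).
Proof.
move=> wN; have wN' : vanish (absz N) w by apply: vanishW wN; lia.
rewrite (ThetaE wN' (leqnn _)); apply: vanish_sum => j _; apply: vanishZ.
by apply: vanishW (vanish_bop _ wN); lia.
Qed.

Lemma Theta_rphi (N M : nat) w n : vanish N w -> (N + absz n <= M)%N ->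
  Theta beta (rphi w n) =
  rphi (Theta beta w) n - \sum_(j < M) theta j *: rphi w (n + j.*2.+1%:Z).
Proof.
move=> wN NM; have wnN : vanish (N + absz n)%N (rphi w n).
  by apply: (vanishW _ (vanish_rphi (n := n) wN)); lia.
rewrite (ThetaE wnN NM) (@ThetaE N M w wN) ?(leq_trans _ NM) ?leq_addr //.
rewrite rphi_sum -sumrB; apply: eq_bigr => j _.
rewrite bop_rphi ?(natr_neq0 3) ?rphiZ ?scalerBr ?opprK //.
by rewrite abszN /= odd_double.
Qed.

(** Only the mode [b_(-m)] of [Theta] fails to commute with [b_m]; its coefficient [2 c^m / m] times
    the central term [m/2] is [c^m]. *)
Lemma Theta_bop (m : nat) w : odd m ->
  Theta beta (bop m%:Z w) = bop m%:Z (Theta beta w) + (beta / 2) ^+ m *: w.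
Proof.
move=> om; have m0 : m%:Z != 0 by lia.
have [N wN] := vanish_exists w; have lb := bop_linear (k := k) m0.
have bwN : vanish (N + m)%N (bop m%:Z w) by rewrite PoszD; apply: vanish_bop.
rewrite (ThetaE bwN (leqnn _)) (ThetaE wN (leq_addr m N)) (lin_sum lb).
rewrite (eq_bigr (fun j : 'I_(N + m) => bop m%:Z (theta j *: bop (- j.*2.+1%:Z) w)
   + (theta j * (m%:R / 2 * (j.*2.+1 == m)%:R)) *: w)); last first.
  move=> j _; have oj : odd j.*2.+1 by rewrite /= odd_double.
  by rewrite (linZ lb) bop_heisenberg // -(scalerA (theta j)) -scalerDr.
rewrite big_split; congr (_ + _).
have mN : (m./2 < N + m)%N by lia.
rewrite (bigD1 (Ordinal mN)) //= big1 ?addr0 => [|j jm]; last first.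
  rewrite (_ : (_ == m) = false) ?mulr0 ?scale0r //.
  by apply/negbTE; apply: contra jm => jm; apply/eqP/val_inj => /=; lia.
have mE : m./2.*2.+1 = m by lia.
rewrite /theta mE eqxx mulr1; congr (_ *: _).
case: m om {m0 lb bwN mN mE} => // m _; have := natr_neq0 m; have := natr_neq0 1.
by move=> two_neq0 m_neq0; field; rewrite nat1r two_neq0.
Qed.

End Theta.

(** * Conjugation by the exponential of Theta *)

(** Rearranges the Cauchy product of two truncated exponential series. *)
Lemma sum_triangle (V : nmodType) (J : nat) (F : nat -> nat -> V) :
    (forall a b, (J <= a + b)%N -> F a b = 0) ->
  \sum_(j < J) \sum_(a < j.+1) F a (j - a)%N = \sum_(a < J) \sum_(b < J) F a b.
Proof.
move=> F0; transitivity (\sum_(j < J) \sum_(a < J | (a <= j)%N) F a (j - a)%N).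
  by apply: eq_bigr => j _; rewrite (big_ord_widen J (fun a => F a (j - a)%N)).
rewrite (exchange_big_dep xpredT) //=; apply: eq_bigr => a _.
rewrite -(big_mkord (fun j => (a <= j)%N) (fun j => F a (j - a)%N)).
rewrite (@big_cat_nat _ _ _ a) ?(ltnW (ltn_ord a)) //= big_nat_cond big1 ?add0r; last first.
  by move=> j /andP[/andP[_ ja] aj]; lia.
rewrite -{1}[a : nat]add0n big_addn big_mkord.
rewrite (big_ord_widen_cond J (fun b => (a <= b + a)%N)
  (fun b => F a (b + a - a)%N)) ?leq_subr //.
rewrite [LHS]big_mkcond /=; apply: eq_bigr => b _.
by rewrite addnK leq_addl /=; case: ltnP => // Jab; rewrite F0 //; lia.
Qed.

Section ExpTheta.
Context (k : fieldType) (char0 : [pchar k] =i pred0) (beta : k).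
Local Notation E := (fockE k).
Local Notation T := (Theta beta).
Local Notation c := (beta / 2).
Local Notation theta := (theta beta).
Implicit Types (w : E).

Lemma Theta_rphi_large (N M : nat) w n : vanish N w -> N%:Z < n + M%:Z ->
  T (rphi w n) = rphi (T w) n - \sum_(j < M) theta j *: rphi w (n + j.*2.+1%:Z).
Proof.
move=> wN NM; rewrite (Theta_rphi char0 (M := (M + (N + absz n))%N) _ wN) ?leq_addl //.
congr (_ - _); rewrite big_split_ord /= [X in _ + X]big1 ?addr0 // => j _.
by rewrite (vanish_rphi0 wN) ?scaler0 //; lia.
Qed.

Definition divpow j w := (j`!%:R)^-1 *: iter j T w.

Lemma fact_neq0 j : j`!%:R != 0 :> k.
Proof. by rewrite -(prednK (fact_gt0 j)) natr_neq0. Qed.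

Lemma divpowS j w : j.+1%:R *: divpow j.+1 w = T (divpow j w).
Proof.
rewrite /divpow (linZ (Theta_linear beta)) scalerA; congr (_ *: _).
by rewrite factS natrM invfM mulrA divff ?mul1r ?natr_neq0.
Qed.

Lemma divpow_linear j : linear (divpow j).
Proof.
have lT : linear (iter j T).
  by elim: j => // j IHj a u v; rewrite !iterS IHj (Theta_linear beta).
by move=> a u v; rewrite /divpow lT scalerDr !scalerA mulrC.
Qed.

Lemma vanish_divpow (N : int) j w : vanish N w -> vanish (N - j%:Z) (divpow j w).
Proof.
move=> wN; apply: vanishZ; elim: j => [|j IHj]; first by rewrite subr0.
by rewrite iterS; apply: vanishW (vanish_Theta beta IHj); lia.
Qed.

Lemma divpow_eq0 (N j : nat) w : vanish N w -> (N < j)%N -> divpow j w = 0.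
Proof. by move=> wN Nj; apply: vanish_lt0 (vanish_divpow (j := j) wN); lia. Qed.

Local Notation expT := (op_exp T).

Lemma expThetaE (N M : nat) w : vanish N w -> (N < M)%N ->
  expT w = \sum_(j < M) divpow j w.
Proof.
by move=> wN NM; apply: fsbigT_nat => j Mj; apply: (divpow_eq0 wN); lia.
Qed.

Lemma expTheta_linear : linear expT.
Proof.
move=> a u v; have [N uN] := vanish_exists u; have [M vM] := vanish_exists v.
pose L := maxn N M; have uL : vanish L u by apply: vanishW uN; lia.
have vL : vanish L v by apply: vanishW vM; lia.
have wL : vanish L (a *: u + v) by apply: vanishD => //; apply: vanishZ.
rewrite !(@expThetaE L L.+1) // scaler_sumr -big_split /=; apply: eq_bigr => j _.
exact: divpow_linear.
Qed.

Lemma vanish_expTheta (N : int) w : vanish N w -> vanish N (expT w).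
Proof.
move=> wN; have wN' : vanish (absz N) w by apply: vanishW wN; lia.
rewrite (expThetaE wN' (ltnSn _)); apply: vanish_sum => j _.
by apply: vanishW (vanish_divpow (j := j) wN); lia.
Qed.

(** [Theta] strictly lowers the degree, and no degree is below 0. *)
Lemma expTheta_id w : vanish 0 w -> expT w = w.
Proof.
by move=> w0; rewrite (@expThetaE 0 1) // big_ord1 /divpow /= fact0 invr1 scale1r.
Qed.

(** The commutator of [Theta] with [b_m] is the scalar [c^m], so conjugation by the exponential just
    adds this scalar to [b_m]. *)
Lemma expTheta_bop (m : nat) w : odd m ->
  expT (bop m%:Z w) = bop m%:Z (expT w) + c ^+ m *: expT w.
Proof.
move=> om; have m0 : m%:Z != 0 by lia.
have lb := bop_linear (k := k) m0; have lT := Theta_linear beta.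
have iterT j : iter j.+1 T (bop m%:Z w) =
    bop m%:Z (iter j.+1 T w) + (j.+1%:R * c ^+ m) *: iter j T w.
  elim: j => [|j IHj]; first by rewrite /= Theta_bop // mul1r.
  rewrite iterS IHj (linD lT) Theta_bop // (linZ lT (_ * _)) -!iterS -addrA -scalerDl.
  by congr (_ + _ *: _); rewrite -[j.+2]addn1 natrD mulrDl mul1r addrC.
have [N wN] := vanish_exists w.
have bwN : vanish (N + m)%N (bop m%:Z w) by rewrite PoszD; apply: vanish_bop.
rewrite (expThetaE bwN (M := (N + m).+2)) ?leqnSn //.
rewrite (expThetaE wN (M := (N + m).+2)) ?ltnS ?(leq_trans (leq_addr m N)) ?leqnSn //.
rewrite [X in c ^+ m *: X]big_ord_recr /= (divpow_eq0 wN) ?addr0 ?ltnS ?leq_addr //.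
rewrite (lin_sum lb) [LHS]big_ord_recl [X in _ = X + _]big_ord_recl -addrA scaler_sumr.
rewrite -big_split; congr (_ + _).
  by rewrite /divpow /= fact0 invr1 !scale1r.
apply: eq_bigr => j _; rewrite /= /bump /= add1n {1}/divpow iterT scalerDr.
congr (_ + _); first by rewrite -(linZ lb).
rewrite /divpow !scalerA; congr (_ *: _).
by rewrite factS natrM invfM mulrACA mulVf ?natr_neq0 // mul1r mulrC.
Qed.

Section ShiftConjugation.
Context (M : nat) (n : int).

(** The coefficient of [x^n] in [q(1/x) phi(x)], cut to [M] modes. The cut loses nothing as soon as
    [n + M] exceeds the degree bound of [w]. *)
Definition shift_rphi (q : {poly k}) w : E := \sum_(i < M) q`_i *: rphi w (n + i%:Z).

Lemma shift_rphiDl p q w : shift_rphi (p + q) w = shift_rphi p w + shift_rphi q w.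
Proof. by rewrite -big_split /=; apply: eq_bigr => i _; rewrite coefD scalerDl. Qed.

Lemma shift_rphiZl a q w : shift_rphi (a *: q) w = a *: shift_rphi q w.
Proof. by rewrite scaler_sumr; apply: eq_bigr => i _; rewrite coefZ scalerA. Qed.

Lemma shift_rphi_suml I (r : seq I) (P : pred I) (F : I -> {poly k}) w :
  shift_rphi (\sum_(i <- r | P i) F i) w = \sum_(i <- r | P i) shift_rphi (F i) w.
Proof.
apply: (big_morph (shift_rphi^~ w)) => [p q|]; first exact: shift_rphiDl.
by rewrite -[0 in LHS](scale0r 0) shift_rphiZl scale0r.
Qed.

Lemma shift_rphi_linear q : linear (shift_rphi q).
Proof.
move=> a u v; rewrite scaler_sumr -big_split; apply: eq_bigr => i _ /=.
by rewrite rphiD rphiZ scalerDr !scalerA mulrC.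
Qed.

Lemma shift_rphi_Xn (N : nat) d q w : vanish N w -> N%:Z < n + M%:Z ->
  shift_rphi ('X^d * q) w = \sum_(i < M) q`_i *: rphi w (n + i%:Z + d%:Z).
Proof.
move=> wN NM; pose F i := ('X^d * q)`_i *: rphi w (n + i%:Z).
have FM i : (M <= i)%N -> F i = 0.
  by move=> Mi; rewrite /F (vanish_rphi0 wN) ?scaler0 //; lia.
transitivity (\sum_(i < d + M) F i).
  rewrite (addnC d M) big_split_ord /= [X in _ + X]big1 ?addr0 // => i _.
  by apply: FM; rewrite leq_addr.
rewrite big_split_ord /= big1 ?add0r => [|i _]; last first.
  by rewrite /F coefXnM ltn_ord scale0r.
apply: eq_bigr => i _; rewrite /F coefXnM ltnNge leq_addr addKn.
by congr (_ *: rphi w _); lia.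
Qed.

(** A truncation of [log ((1 - cX)/(1 + cX))] with [X = 1/x]: the commutator of [Theta] with
    [phi(x)] is multiplication by it. *)
Definition theta_poly : {poly k} := - \sum_(j < M) theta j *: 'X^(j.*2.+1).

Lemma Theta_shift (N : nat) q w : vanish N w -> N%:Z < n + M%:Z ->
  T (shift_rphi q w) = shift_rphi (theta_poly * q) w + shift_rphi q (T w).
Proof.
move=> wN NM; have lT := Theta_linear beta.
rewrite (lin_sum lT) [RHS]addrC /theta_poly mulNr -scaleN1r shift_rphiZl scaleN1r.
rewrite mulr_suml shift_rphi_suml.
under [X in _ - X]eq_bigr do rewrite -scalerAl shift_rphiZl (shift_rphi_Xn _ _ wN NM).
under [X in _ - X]eq_bigr do rewrite scaler_sumr.
rewrite exchange_big -sumrB; apply: eq_bigr => i _.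
rewrite (linZ lT) (Theta_rphi_large (M := M) wN); last lia.
rewrite scalerBr scaler_sumr; congr (_ - _); apply: eq_bigr => j _.
by rewrite !scalerA mulrC.
Qed.

Definition dpoly b : {poly k} := (b`!%:R)^-1 *: theta_poly ^+ b.

Lemma dpolyS b : b.+1%:R *: dpoly b.+1 = theta_poly * dpoly b.
Proof.
rewrite /dpoly -scalerAr -exprS scalerA; congr (_ *: _).
by rewrite factS natrM invfM mulrA divff ?mul1r ?natr_neq0.
Qed.

(** By [Theta_shift], [Theta] acts as the sum of two commuting operations: multiplication of [q] by
    [theta_poly], and [Theta] on [w]. This is the binomial formula for divided powers. *)
Lemma divpow_shift (N : nat) j q w : vanish N w -> N%:Z < n + M%:Z ->
  divpow j (shift_rphi q w) =
  \sum_(a < j.+1) shift_rphi (dpoly (j - a) * q) (divpow a w).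
Proof.
move=> wN NM; elim: j => [|j IHj].
  rewrite big_ord1 subnn /dpoly /divpow /= fact0 invr1 !scale1r.
  by rewrite expr0 mul1r.
apply: (scalerI (natr_neq0 char0 j)); rewrite divpowS IHj.
have lT := Theta_linear beta; rewrite (lin_sum lT).
pose S a b := shift_rphi (dpoly b * q) (divpow a w).
transitivity (\sum_(a < j.+1) ((j - a).+1%:R *: S a (j - a).+1 + a.+1%:R *: S a.+1 (j - a)%N)).
  apply: eq_bigr => a _; rewrite (Theta_shift (N := N)) //; last first.
    by apply: vanishW (vanish_divpow wN); lia.
  congr (_ + _); first by rewrite mulrA -dpolyS -scalerAl shift_rphiZl.
  by rewrite -divpowS (linZ (shift_rphi_linear _)).
(* Both families of terms are brought to the same index, where the weights add up:
   [(j + 1 - a) + a = j + 1]. *)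
transitivity (\sum_(a < j.+2) ((j.+1 - a)%:R *: S a (j.+1 - a)%N + a%:R *: S a (j.+1 - a)%N)).
  rewrite [in RHS]big_split /= [X in _ = X + _]big_ord_recr /= subnn scale0r addr0.
  rewrite [X in _ = _ + X]big_ord_recl /= scale0r add0r big_split; congr (_ + _).
  by apply: eq_bigr => a _; rewrite subSn // -ltnS.
rewrite scaler_sumr; apply: eq_bigr => a _.
by rewrite -scalerDl -natrD subnK // -ltnS.
Qed.

Lemma vanish_shift (N : nat) q w : vanish N w -> vanish (N%:Z - n) (shift_rphi q w).
Proof.
move=> wN; apply: vanish_sum => i _; apply: vanishZ.
by apply: vanishW (vanish_rphi wN); lia.
Qed.

Lemma shift_rphi_low b q w : (M <= b)%N -> shift_rphi ('X^b * q) w = 0.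
Proof.
move=> Mb; apply: big1 => i _.
by rewrite coefXnM (leq_trans (ltn_ord i)) // scale0r.
Qed.

Lemma theta_polyX : exists p, theta_poly = 'X * p.
Proof.
exists (- \sum_(j < M) theta j *: 'X^(j.*2)); rewrite mulrN mulr_sumr; congr (- _).
by apply: eq_bigr => j _; rewrite -scalerAr -exprS.
Qed.

(** [theta_poly] has no constant term, so its [b]-th power falls beyond the cut for [b >= M], while
    [divpow a w] is 0 for [a > N]. Hence the double series is finite and any large [J] serves. *)
Lemma expTheta_shift (N J : nat) q w : vanish N w -> N%:Z < n + M%:Z ->
    (N + M + absz n <= J)%N ->
  expT (shift_rphi q w) = shift_rphi ((\sum_(b < J) dpoly b) * q) (expT w).
Proof.
move=> wN NM NJ; rewrite (@expThetaE (absz (N%:Z - n)) J.+1 (shift_rphi q w)); last 2 first.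
- by apply: vanishW (vanish_shift q wN); lia.
- by lia.
rewrite (expThetaE wN (M := J.+1)); last by lia.
under eq_bigr do rewrite (divpow_shift _ _ wN NM).
have [p pE] := theta_polyX.
rewrite (sum_triangle (F := fun a b => shift_rphi (dpoly b * q) (divpow a w))); last first.
  move=> a b ab; have [Na|aN] := ltnP N a.
    by rewrite (divpow_eq0 wN Na) (lin0 (shift_rphi_linear _)).
  rewrite /dpoly -scalerAl shift_rphiZl pE exprMn -mulrA shift_rphi_low ?scaler0 //.
  by lia.
rewrite (lin_sum (shift_rphi_linear _)); apply: eq_bigr => a _.
rewrite -shift_rphi_suml big_ord_recr /= shift_rphiDl mulr_suml.
rewrite [X in _ + X](_ : _ = 0) ?addr0 //.
rewrite /dpoly -scalerAl shift_rphiZl pE exprMn -mulrA shift_rphi_low ?scaler0 //.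
by lia.
Qed.

End ShiftConjugation.

End ExpTheta.

(** * The exponential of [theta_poly] is [(1 - cX)/(1 + cX)] up to truncation *)

Section ConjugationSeries.
Context (k : fieldType) (char0 : [pchar k] =i pred0) (beta : k).
Local Notation c := (beta / 2).
Context (M : nat).
Local Notation D := (theta_poly beta M).

(** The derivative of the logarithm is a geometric series, cut here at [M] terms. It yields a
    differential equation for the exponential, which stands in for the identity between exponential
    and logarithm. *)
Lemma theta_poly_deriv :
  (1 - c ^+ 2 *: 'X^2) * D^`() = (- beta) *: (1 - (c ^+ 2 *: 'X^2) ^+ M).
Proof.
rewrite /theta_poly derivN (big_morph _ (@derivD _) (deriv0 _)).
have -> : \sum_(j < M) (theta beta j *: 'X^(j.*2.+1))^`() =
    beta *: \sum_(j < M) (c ^+ 2 *: 'X^2) ^+ j :> {poly k}.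
  rewrite scaler_sumr; apply: eq_bigr => j _.
  rewrite derivZ derivXn exprZn -exprM mul2n -exprM mul2n /= scalerA -scaler_nat scalerA.
  congr (_ *: _); rewrite /theta exprS; have := natr_neq0 char0 1.
  by move=> two_neq0; field; rewrite two_neq0 nat1r natr_neq0.
rewrite mulrN -scalerAr scaleNr; congr (- (_ *: _)).
by rewrite -[RHS]opprB subrX1 -mulNr opprB.
Qed.

Definition esum J := \sum_(b < J) dpoly beta M b.

Lemma esum_deriv J : (esum J.+1)^`() = D^`() * esum J.
Proof.
rewrite /esum (big_morph _ (@derivD _) (deriv0 _)) big_ord_recl.
rewrite /dpoly expr0 derivZ -polyC1 derivC scaler0 add0r mulr_sumr.
apply: eq_bigr => b _; rewrite lift0 derivZ deriv_exp /=.
rewrite -scaler_nat scalerA -scalerAr; congr (_ *: _).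
by rewrite factS natrM invfM mulrAC mulVf ?mul1r ?natr_neq0.
Qed.

Lemma dpoly_low b i : (i < b)%N -> (dpoly beta M b)`_i = 0.
Proof.
move=> ib; have [p pE] := theta_polyX beta M.
by rewrite /dpoly pE exprMn coefZ coefXnM ib mulr0.
Qed.

(** The coefficient of [X^i] in [(1 - c^2 X^2) E' = - beta E]. The bound [i < M] hides the
    truncation of the logarithm, and [i + 1 < J] that of the exponential. *)
Lemma esum_rec J i : (i < M)%N -> (i.+1 < J)%N ->
  i.+1%:R * (esum J)`_i.+1 =
  c ^+ 2 * (if i is j.+2 then j.+1%:R * (esum J)`_j.+1 else 0) - beta * (esum J)`_i.
Proof.
case: J => // J iM iJ; have := congr1 (fun p => (p * esum J)`_i) theta_poly_deriv.
rewrite -mulrA -esum_deriv mulrBl mul1r coefB -scalerAl coefZ coefXnM coef_deriv.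
rewrite coef_deriv -[(esum _)`__ *+ i.+1]mulr_natl.
rewrite -[(esum _)`__ *+ _]mulr_natl => /eqP; rewrite subr_eq => /eqP ->.
rewrite addrC; congr (_ + _).
  by congr (_ * _); case: i {iM iJ} => [|[|i]] //=; rewrite subn2.
rewrite -scalerAl coefZ mulrBl mul1r coefB exprZn -!exprM -scalerAl coefZ coefXnM.
rewrite (leq_trans iM) ?leq_pmull // mulr0 subr0 mulNr; congr (- (_ * _)).
rewrite /esum big_ord_recr coefD /=.
by rewrite dpoly_low ?addr0.
Qed.

(** [1, -2c, 2c^2, -2c^3, ...] are the coefficients of [(1 - cX)/(1 + cX)]; they satisfy the
    recurrence of [esum_rec]. *)
Lemma esumE J i : (i <= M)%N -> (i < J)%N ->
  (esum J)`_i = if i == 0%N then 1 else 2 * (- c) ^+ i.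
Proof.
have two0 := natr_neq0 char0 1.
have e0 : (0 < J)%N -> (esum J)`_0 = 1.
  case: J => // J _; rewrite /esum big_ord_recl coefD coef_sum big1 ?addr0; last first.
    by move=> b _; rewrite dpoly_low.
  by rewrite /dpoly fact0 invr1 scale1r expr0 coef1.
elim/ltn_ind: i => -[|[|i]] IHi iM iJ /=; first exact: e0.
  have := esum_rec iM iJ; rewrite mulr0 sub0r mul1r => ->.
  by rewrite e0 ?(ltn_trans _ iJ) // expr1; field.
have := esum_rec iM iJ; rewrite (IHi i.+1) ?(ltnW iM) ?(ltnW iJ) //=.
case: i IHi iM iJ => [|i] IHi iM iJ /= rec.
  by apply: (mulfI two0); rewrite rec; field.
move: rec; rewrite (IHi i.+1) ?(ltnW (ltnW iM)) ?(ltnW (ltnW iJ)) ?ltnS ?leqnSn //= => rec.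
by apply: (mulfI (natr_neq0 char0 i.+2)); rewrite rec !exprS; field.
Qed.

Lemma esum_mul J i : (i <= M)%N -> (i < J)%N ->
  (esum J * (1 + c *: 'X))`_i = (1 - c *: 'X)`_i.
Proof.
move=> iM iJ; rewrite mulrDr mulr1 -scalerAr coefD coefB !coefZ coefMX coef1 coefX.
rewrite esumE //; case: i iM iJ => [|i] iM iJ /=; first by rewrite !mulr0 addr0 subr0.
rewrite esumE ?(ltnW iM) ?(ltnW iJ) //; have two0 := natr_neq0 char0 1.
by case: i {iM iJ} => [|i] /=; rewrite ?exprS; field.
Qed.

End ConjugationSeries.

Section Conjugation.
Context (k : fieldType) (char0 : [pchar k] =i pred0) (beta : k).
Local Notation c := (beta / 2).
Local Notation expT := (op_exp (Theta beta)).

(** Taking [q = 1 + cX] in [expTheta_shift] clears the denominator of the conjugation factor, so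
    only two modes remain on each side. *)
Lemma expTheta_conj w n :
  expT (rphi w n) + c *: expT (rphi w (n + 1)) =
  rphi (expT w) n - c *: rphi (expT w) (n + 1).
Proof.
have [N wN] := vanish_exists w; pose M := (N + absz n).+2.
have NM : N%:Z < n + M%:Z by lia.
have shiftE (p : {poly k}) (a : k) (v : fockE k) :
    (forall i, (i < M)%N -> p`_i = (1 + a *: 'X)`_i) ->
    shift_rphi M n p v = rphi v n + a *: rphi v (n + 1).
  move=> pE; rewrite /shift_rphi /M !big_ord_recl big1 ?addr0; last first.
    move=> i _; rewrite pE ?coefD ?coefZ ?coef1 ?coefX /= ?mulr0 ?addr0 ?scale0r //.
    by rewrite /bump /= !add1n !ltnS.
  rewrite !pE // !coefD !coefZ !coef1 !coefX /= mulr0 addr0 scale1r add0r mulr1.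
  by congr (rphi v _ + _); rewrite ?addr0.
have lE := expTheta_linear beta.
rewrite -(linZ lE) -(linD lE) -(shiftE (1 + c *: 'X)) //.
rewrite (expTheta_shift char0 _ _ wN NM (leqnn _)) (shiftE _ (- c)) ?scaleNr //.
by move=> i iM; rewrite esum_mul //; lia.
Qed.
End Conjugation.

(** * The deformed fields *)

Section FpsVariables.
Context (I : choiceType) (R : comNzRingType).
Local Notation S := (fps I R).
Implicit Types (f g : S) (m d : {cmonom I}).

Lemma cmonomP m d : (forall i, m i = d i) -> m = d.
Proof. by move=> md; apply/eqP/cmP. Qed.

Lemma fpsM_coef f g m : (f * g) m =
  \sum_(d \in [set d : {cmonom I} * {cmonom I} | (d.1 * d.2)%M = m]) f d.1 * g d.2.
Proof. by []. Qed.

Lemma fpsD_coef f g m : (f + g) m = f m + g m. Proof. by []. Qed.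
Lemma fpsN_coef f m : (- f) m = - f m. Proof. by []. Qed.
Lemma fps1_coef m : (1 : S) m = (m == 1%M)%:R. Proof. by []. Qed.
Lemma fps_sum_coef T (r : seq T) (P : pred T) (F : T -> S) m :
  (\sum_(i <- r | P i) F i) m = \sum_(i <- r | P i) F i m.
Proof. by apply: (big_morph (fun f : S => f m)). Qed.

Lemma fps_constM c f m : (fps_const c * f) m = c * f m.
Proof.
rewrite fpsM_coef (fsbigE [:: (1%M, m)]) //=.
- by rewrite big_cons big_nil mem_set /= ?mul1m // addr0 /fps_const eqxx mulr1n.
- by move=> d /=; rewrite inE => /eqP -> /=; rewrite mul1m.
move=> [d e] de; rewrite mem_seq1 xpair_eqE /fps_const /=.
have [d1|_] := eqVneq d 1%M; last by rewrite mulr0n mul0r.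
by rewrite -de d1 mul1m eqxx.
Qed.

Fact fps_const_is_zmod_morphism : zmod_morphism (@fps_const I R).
Proof. by move=> a b; apply/funext => m; rewrite /fps_const mulrnBl. Qed.

Fact fps_const_is_monoid_morphism : monoid_morphism (@fps_const I R).
Proof.
split=> // a b; apply/funext => m; rewrite fps_constM /fps_const.
by rewrite mulrnAr.
Qed.

HB.instance Definition _ :=
  GRing.isZmodMorphism.Build R S (@fps_const I R) fps_const_is_zmod_morphism.
HB.instance Definition _ :=
  GRing.isMonoidMorphism.Build R S (@fps_const I R) fps_const_is_monoid_morphism.

Lemma fps_varM i f m : (fps_var i * f) (ucm i * m)%M = f m.
Proof.
rewrite fpsM_coef (fsbigE [:: (ucm i, m)]) //=.
- by rewrite big_cons big_nil mem_set //= addr0 /fps_var eqxx mul1r.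
- by move=> d /=; rewrite inE => /eqP ->.
move=> [d e] de; rewrite mem_seq1 xpair_eqE /fps_var /=.
have [di|_] := eqVneq d (ucm i); last by rewrite mul0r.
move=> /eqP[]; apply/cmonomP => j; have := congr1 (fun c : {cmonom I} => c j) de.
by rewrite /= di !cmM => /addnI.
Qed.

Lemma fps_varM0 i f m : m i = 0%N -> (fps_var i * f) m = 0.
Proof.
move=> mi0; rewrite fpsM_coef fsbig1 // => -[d e] /= de.
rewrite /fps_var; have [di|_] := eqVneq d (ucm i); last by rewrite mul0r.
by move: mi0; rewrite -de di cmM cmUU.
Qed.

Definition xpow (i : I) (n : nat) : {cmonom I} := expcmn (ucm i) n.

Lemma xpow0 i : xpow i 0 = 1%M. Proof. by []. Qed.

Lemma xpowS i n : xpow i n.+1 = (ucm i * xpow i n)%M.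
Proof.
rewrite /xpow /expcmn /iterop; case: n => [|n] /=; last by [].
by apply/cmonomP => j; rewrite cmM cm1 addn0.
Qed.

Lemma xpowE i n j : xpow i n j = if i == j then n else 0%N.
Proof.
elim: n => [|n IHn]; first by rewrite xpow0 cm1; case: eqP.
by rewrite xpowS cmM IHn cmU; case: eqP.
Qed.

Lemma ucm_factor m i : (0 < m i)%N -> exists d, m = (ucm i * d)%M.
Proof.
move=> mi; exists (divcm m (ucm i)); apply/cmonomP => j.
by rewrite cmM divcmE cmU; case: eqP => [<-|]; rewrite ?subn0 // subnKC.
Qed.

Lemma ucmMI i m d : (ucm i * m)%M = (ucm i * d)%M -> m = d.
Proof.
move=> md; apply/cmonomP => j.
by have := congr1 (fun c : {cmonom I} => c j) md; rewrite !cmM => /addnI.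
Qed.

Lemma eq_ucmM i m d : (ucm i * m == ucm i * d)%M = (m == d).
Proof. by apply/eqP/eqP => [/ucmMI|->]. Qed.

(** The series [1/(1 - a x_i)], supported on the powers of [x_i]. *)
Definition geometric (a : R) (i : I) : S :=
  fun m => a ^+ m i *+ (m == xpow i (m i)).

Lemma geometricP a i : geometric a i * (1 - fps_const a * fps_var i) = 1.
Proof.
rewrite mulrC mulrBl mul1r -mulrA; apply/funext => m.
rewrite fpsD_coef fpsN_coef fps_constM fps1_coef.
have [mi0|] := posnP (m i).
  rewrite fps_varM0 // mulr0 subr0 /geometric mi0 xpow0 expr0.
  by case: eqP.
move=> /ucm_factor[d ->]; rewrite fps_varM cmM_eq1 cm1_eq1 /=.
by rewrite /geometric cmM cmUU add1n xpowS exprS mulrnAr eq_ucmM subrr.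
Qed.

(** Makes the quotients in [phi_beta] and [GQ_factor] genuine: by convention a non-unit is its own
    inverse. *)
Lemma fps_unit_linear a i : (1 - fps_const a * fps_var i : S) \is a GRing.unit.
Proof. by apply/unitrPr; exists (geometric a i); rewrite mulrC geometricP. Qed.

End FpsVariables.

Section PolyAction.
Context (k : comNzRingType) (V : lmodType k).
Implicit Types (p q : {poly k}) (f : int -> V) (n : int).

(** The coefficient of [z^n] in [p(z) f(z)], where [f(z)] is the two-sided series with coefficients
    [f n]. *)
Definition polact p f n : V := \sum_(i < size p) p`_i *: f (n - i%:Z).

Lemma polactE N p f n : (size p <= N)%N ->
  polact p f n = \sum_(i < N) p`_i *: f (n - i%:Z).
Proof.
move=> pN; rewrite -(subnKC pN) big_split_ord /= [X in _ + X]big1 ?addr0 // => i _.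
by rewrite nth_default ?scale0r // leq_addr.
Qed.

Lemma polactD p q f n : polact (p + q) f n = polact p f n + polact q f n.
Proof.
rewrite !(@polactE (maxn (size p) (size q))) ?leq_maxl ?leq_maxr ?size_polyD //.
by rewrite -big_split; apply: eq_bigr => i _; rewrite coefD scalerDl.
Qed.

Lemma polactZ a p f n : polact (a *: p) f n = a *: polact p f n.
Proof.
rewrite !(@polactE (size p)) ?size_scale_leq // scaler_sumr.
by apply: eq_bigr => i _; rewrite coefZ scalerA.
Qed.

Lemma polact_sum T (r : seq T) (P : pred T) (F : T -> {poly k}) f n :
  polact (\sum_(i <- r | P i) F i) f n = \sum_(i <- r | P i) polact (F i) f n.
Proof.
apply: (big_morph (fun p => polact p f n)) => [p q|]; first exact: polactD.
by rewrite -[0 in LHS](scale0r 0) polactZ scale0r.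
Qed.

Lemma polactC a f n : polact a%:P f n = a *: f n.
Proof. by rewrite (@polactE 1) ?size_polyC_leq1 // big_ord1 coefC subr0. Qed.

Lemma polactMX p f n : polact (p * 'X) f n = polact p f (n - 1).
Proof.
rewrite (@polactE (size p).+1) ?size_polyMX_leq //; last first.
  by have [->|p0] := eqVneq p 0; rewrite ?mul0r ?size_poly0 // size_mulX.
rewrite big_ord_recl coefMX scale0r add0r; apply: eq_bigr => i _.
by rewrite coefMX /=; congr (_ *: f _); rewrite /bump /=; lia.
Qed.

Lemma polactM p q f n : polact (p * q) f n = polact p (polact q f) n.
Proof.
elim/poly_ind: p n => [|p a IHp] n.
  by rewrite mul0r /polact size_poly0 !big_ord0.
rewrite mulrDl !polactD -mulrA (mulrC 'X) mulrA !polactMX IHp; congr (_ + _).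
by rewrite mul_polyC polactZ polactC.
Qed.

End PolyAction.

Lemma divr_expS (R : comUnitRingType) (x v : R) a :
  v \is a GRing.unit -> x * (x / v) ^+ a = (x / v) ^+ a.+1 * v.
Proof. by move=> vU; rewrite exprS mulrAC divrK. Qed.

Section LaurentCoefficients.
Context (k : fieldType) (beta : k).
Local Notation c := (beta / 2).
Local Notation u := (fps_var tt : fps unit k).
Local Notation y := (u / (1 + fps_const c * u)).

(** With [u = z^-1], the coefficient of [z^-j] in [(z + c)^-a]. *)
Definition ycoef (a j : nat) : k := (y ^+ a) (xpow tt j).

Lemma ycoef_rec a j : ycoef a.+1 j.+1 = ycoef a j - c * ycoef a.+1 j.
Proof.
have uU : (1 + fps_const c * u) \is a GRing.unit.
  by rewrite -[fps_const c]opprK mulNr -rmorphN fps_unit_linear.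
have -> : ycoef a j = (u * y ^+ a) (xpow tt j.+1) by rewrite xpowS fps_varM.
rewrite (divr_expS _ _ uU) /ycoef; move: (y ^+ a.+1) => f.
by rewrite mulrDr mulr1 mulrCA fpsD_coef fps_constM (mulrC f) xpowS fps_varM addrK.
Qed.

Lemma ycoef0 j : ycoef 0 j = (j == 0%N)%:R.
Proof.
rewrite /ycoef expr0 fps1_coef; case: j => [|j]; first by rewrite xpow0 !eqxx.
by rewrite xpowS cmM_eq1 cm1_eq1.
Qed.

Lemma ycoefS0 a : ycoef a.+1 0 = 0.
Proof. by rewrite /ycoef exprS -mulrA xpow0 fps_varM0 // cm1. Qed.

Lemma ycoef_low a j : (j < a)%N -> ycoef a j = 0.
Proof.
elim: j a => [|j IHj] [|a] //; first by rewrite ycoefS0.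
by move=> ja; rewrite ycoef_rec !IHj ?mulr0 ?subr0 // ltnW.
Qed.

(** The coefficient of [z^n] in [(z + beta/2)^m], expanded in [z^-1]. *)
Definition shift_coef (m n : int) : k :=
  match m, n with
  | Posz a, Posz j => (('X + c%:P) ^+ a)`_j
  | Negz a, Negz j => ycoef a.+1 j.+1
  | _, _ => 0
  end.

(** This is [(z + c)^(m+1) = (z + c) (z + c)^m]. It holds across [m = -1] too, because negative
    powers are expanded in [z^-1]. *)
Lemma shift_coef_rec m n :
  shift_coef (m + 1) n = shift_coef m (n - 1) + c * shift_coef m n.
Proof.
case: m => [a|a].
  rewrite -PoszD addn1; case: n => [[|j]|j] /=; last by rewrite mulr0 addr0.
    by rewrite exprSr mulrDr coefD coefMX coefMC /= !add0r [LHS]mulrC.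
  by rewrite subn1 exprSr mulrDr coefD coefMX coefMC [_`__ * _]mulrC.
have -> : Negz a + 1 = if a is b.+1 then Negz b else 0 by case: a => //; lia.
case: n => [[|j]|j].
- case: a => [|a] /=; rewrite mulr0 addr0 ycoef_rec ?ycoefS0 ?mulr0 ?subr0 ?ycoef0 //.
  by rewrite expr0 coef1.
- have -> : j.+1%:Z - 1 = j by lia.
  by case: a => [|a] /=; rewrite ?expr0 ?coef1 /= mulr0 addr0.
have -> : Negz j - 1 = Negz j.+1 by lia.
rewrite /shift_coef ycoef_rec subrK; case: a => [|a] //.
by rewrite ycoef0.
Qed.

Lemma shift_coef_low m n : m < n -> shift_coef m n = 0.
Proof.
case: m n => [a|a] [j|j] mn //=; last by rewrite ycoef_low //; lia.
apply: nth_default; rewrite (leq_trans (size_poly_exp_leq _ _)) //.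
by rewrite size_XaddC mul1n; lia.
Qed.

Lemma shift_coef_sign m n : (0 <= m) != (0 <= n) -> shift_coef m n = 0.
Proof. by case: m n => [a|a] [j|j]. Qed.

Lemma shift_coef0n m : shift_coef 0 m = (m == 0)%:R.
Proof. by case: m => [j|j] //=; rewrite expr0 coef1. Qed.

Lemma shift_coefn0 (m : nat) : shift_coef m 0 = c ^+ m.
Proof. by rewrite /= -horner_coef0 horner_exp !hornerE. Qed.

Lemma shift_coef_expr l m n :
  shift_coef (m + l%:Z) n = polact (('X + c%:P) ^+ l) (fun j => (shift_coef m j : k^o)) n.
Proof.
elim: l n => [|l IHl] n; first by rewrite addr0 expr0 -polyC1 polactC scale1r.
have -> : m + l.+1%:Z = m + l%:Z + 1 by lia.
rewrite shift_coef_rec !IHl exprSr mulrDr polactD polactMX [_ * c%:P]mulrC mul_polyC.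
by rewrite polactZ.
Qed.

End LaurentCoefficients.

Section ShiftSum.
Context (k : fieldType) (beta : k).
Local Notation c := (beta / 2).
Local Notation cf := (shift_coef beta).
Implicit Types (m n : int).

(** The coefficient of [z^n] in [V(z + c)], where [V(x)] is the series of the [V m x^m]. As
    [(z + c)^m] has no power above [m], the sum is finite once [V m] vanishes for large [m]. *)
Definition shift_sum (W : lmodType k) n (V : int -> W) : W := 
  \sum_(m \in [set: int]) cf m n *: V m.

Lemma shift_sumE (W : lmodType k) (N K : nat) n (V : int -> W) :
    (forall m, N%:Z < m -> V m = 0) ->
    (N < K)%N -> (absz n <= K)%N ->
  shift_sum n V = \sum_(m <- zrange K) cf m n *: V m.
Proof.
move=> VN NK nK; apply: fsbigT_int => m /orP[mK|Km].
  by rewrite shift_coef_low ?scale0r //; lia.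
by rewrite VN ?scaler0 //; lia.
Qed.

Lemma shift_sum_linear (W : lmodType k) n a (N : nat) (U V : int -> W) :
    (forall m, N%:Z < m -> U m = 0) -> (forall m, N%:Z < m -> V m = 0) ->
  shift_sum n (fun m => a *: U m + V m) = a *: shift_sum n U + shift_sum n V.
Proof.
move=> UN VN; rewrite !(@shift_sumE _ N (N + absz n).+1) //; try lia.
  rewrite scaler_sumr -big_split; apply: eq_bigr => m _ /=.
  by rewrite scalerDr !scalerA mulrC.
by move=> m Nm; rewrite UN // VN // scaler0 addr0.
Qed.

Lemma shift_sum_morph (W W' : lmodType k) (f : W -> W') n (N : nat) (V : int -> W) :
    linear f -> (forall m, N%:Z < m -> V m = 0) ->
  f (shift_sum n V) = shift_sum n (fun m => f (V m)).
Proof.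
move=> lf VN; rewrite !(@shift_sumE _ N (N + absz n).+1) //; try lia.
  by rewrite (lin_sum lf); apply: eq_bigr => m _; rewrite (linZ lf).
by move=> m Nm; rewrite VN // (lin0 lf).
Qed.

Lemma shift_sum_reindex (W : lmodType k) (s : int) n (V : int -> W) :
  \sum_(m \in [set: int]) cf (m + s) n *: V m = shift_sum n (fun m => V (m - s)).
Proof.
rewrite -(fsbigT_intB s) /shift_sum; apply: eq_fsbigr => m _.
by rewrite subrK.
Qed.

(** The coefficients [V (m - 1) - c V m] belong to [(x - c) V(x)], which is [z V(z + c)] at
    [x = z + c]. *)
Lemma shift_sumB (W : lmodType k) n (N : nat) (V : int -> W) :
    (forall m, N%:Z < m -> V m = 0) ->
  shift_sum n V = shift_sum (n + 1) (fun m => V (m - 1) - c *: V m).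
Proof.
move=> VN; have VN' m : N.+1%:Z < m -> V m = 0 by move=> Nm; apply: VN; lia.
have VN1 m : N.+1%:Z < m -> V (m - 1) = 0 by move=> Nm; apply: VN; lia.
transitivity (shift_sum (n + 1) (fun m => - c *: V m + V (m - 1))); last first.
  by congr shift_sum; apply/funext => m; rewrite scaleNr addrC.
rewrite (shift_sum_linear _ _ VN' VN1) -shift_sum_reindex scaleNr addrC.
pose K := (N + absz n).+2.
rewrite [X in X - _](@fsbigT_int _ K) => [|m /orP[mK|Km]]; last 2 first.
- by rewrite shift_coef_low ?scale0r //; lia.
- by rewrite VN ?scaler0 //; lia.
rewrite !(@shift_sumE _ N K) //; try by rewrite /K; lia.
rewrite scaler_sumr -sumrB; apply: eq_bigr => m _.
rewrite scalerA -scalerBl shift_coef_rec addrK; congr (shift_coef _ _ _ *: _); lia.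
Qed.

End ShiftSum.

Section PhiBeta.
Context (k : fieldType) (char0 : [pchar k] =i pred0) (beta : k).
Local Notation E := (fockE k).
Local Notation c := (beta / 2).
Local Notation expT := (op_exp (Theta beta)).
Local Notation cf := (shift_coef beta).
Local Notation shift_sum := (shift_sum beta).
Implicit Types (w : E) (m n : int) (V : int -> E).

(** Both branches of the definition are the single substitution [x = z + c] in [phi(x)]; by
    [shift_coef_sign] the two half-series do not mix. *)
Lemma phi_betaE n w : phi_beta beta n w = shift_sum n (rphi w).
Proof.
rewrite /shift_sum; case: n => j.
  rewrite -(fsbig_widen [set z : int | 0 <= z]%classic) //; last first.
    move=> z /= [_ z0]; rewrite shift_coef_sign ?scale0r //.
    by rewrite lez_nat leq0n; apply/negP => /eqP.
  rewrite (reindex_fsbig Posz [set: nat]%classic) //.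
  by split=> [a _|a b _ _ [] //|[a|//] _] //=; exists a.
rewrite -(fsbig_widen [set z : int | z < 0]%classic) //; last first.
  move=> z /= [_ z0]; rewrite shift_coef_sign ?scale0r //.
  by case: z z0 => // z [].
rewrite (reindex_fsbig (fun m : nat => - m%:Z) [set m : nat | (0 < m)%N]%classic) //.
  by apply: eq_fsbigr => -[|m] //; rewrite mem_setE.
split=> [m|a b _ _ /oppr_inj []|[//|m] _] //=; first by lia.
by exists m.+1.
Qed.

Lemma vanish_rphi_high (N : nat) w : vanish N w -> forall m, N%:Z < m -> rphi w m = 0.
Proof. by move=> wN m; apply: vanish_rphi0. Qed.

Lemma phi_beta_linear n : linear (phi_beta beta n).
Proof.
move=> a u v; have [N uN] := vanish_exists u; have [M vM] := vanish_exists v.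
rewrite !phi_betaE -(@shift_sum_linear _ _ _ _ _ (maxn N M)).
- by congr shift_sum; apply/funext => m; apply: rphi_linear.
- by move=> m ?; apply: vanish_rphi0 uN _; lia.
- by move=> m ?; apply: vanish_rphi0 vM _; lia.
Qed.

(** At [x = z + c] the factors [x - c] and [x + c] of [expTheta_conj] become [z] and [z + beta]. *)
Lemma expTheta_phi_beta n w :
  expT (phi_beta beta n w) + beta *: expT (phi_beta beta (n + 1) w) =
  phi_beta beta n (expT w).
Proof.
have [N wN] := vanish_exists w; have lE := expTheta_linear beta.
have wN' := vanish_rphi_high wN; have ewN := vanish_rphi_high (vanish_expTheta beta wN).
rewrite !phi_betaE !(shift_sum_morph beta _ lE wN').
pose U m := expT (rphi w m); pose V m := rphi (expT w) m.
have UN m : N%:Z < m -> U m = 0 by move=> Nm; rewrite /U wN' // (lin0 lE).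
rewrite -/U -[rphi (expT w)]/V.
have UV m : V (m - 1) - c *: V m = U (m - 1) + c *: U m.
  by rewrite /U /V; have := expTheta_conj char0 beta w (m - 1); rewrite subrK.
rewrite (shift_sumB beta n UN) (shift_sumB beta n (V := V) ewN) addrC.
have UN1 m : N.+1%:Z < m -> U (m - 1) - c *: U m = 0.
  by move=> Nm; rewrite !UN ?scaler0 ?subr0 //; lia.
rewrite -(@shift_sum_linear _ _ _ _ _ N.+1) //; last by move=> m Nm; apply: UN; lia.
congr shift_sum; apply/funext => m; rewrite UV addrCA; congr (_ + _).
rewrite -scalerBl; congr (_ *: _); have := natr_neq0 char0 1.
by move=> two0; field.
Qed.

(** Commuting with [b_l] shifts the modes of [phi(x)] by [l], that is, multiplies the field by
    [x^l = (z + c)^l]. *)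
Lemma phi_beta_bop (l : nat) n w : odd l ->
  phi_beta beta n (bop l%:Z w) = bop l%:Z (phi_beta beta n w) +
    polact (('X + c%:P) ^+ l) (fun j => phi_beta beta j w) n.
Proof.
move=> ol; have l0 : l%:Z != 0 by lia.
have lb := bop_linear (k := k) l0.
have [N wN] := vanish_exists w; have wN' := vanish_rphi_high wN.
rewrite !phi_betaE (shift_sum_morph beta _ lb wN').
pose L := (N + l)%N; pose U m := rphi w (m - l%:Z).
have UL m : L%:Z < m -> U m = 0 by move=> Lm; apply: wN'; lia.
transitivity (shift_sum n (fun m => 1 *: bop l%:Z (rphi w m) + U m)).
  congr shift_sum; apply/funext => m.
  by rewrite scale1r bop_rphi ?subrK // (natr_neq0 char0 3).
have BL m : L%:Z < m -> bop l%:Z (rphi w m) = 0.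
  by move=> Lm; rewrite wN' ?(lin0 lb) //; lia.
rewrite (shift_sum_linear beta _ _ BL UL).
rewrite scale1r; congr (_ + _); rewrite /U -shift_sum_reindex.
pose sz := size (('X + c%:P) ^+ l); pose K := (N + absz n + sz + l).+1.
rewrite (@fsbigT_int _ K) => [|m /orP[mK|Km]]; last 2 first.
- by rewrite shift_coef_low ?scale0r //; lia.
- by rewrite wN' ?scaler0 //; lia.
under eq_bigr do rewrite shift_coef_expr scaler_suml.
rewrite exchange_big; apply: eq_bigr => i _; have isz : (i < sz)%N := ltn_ord i.
rewrite phi_betaE (@shift_sumE _ _ _ N K) //; try by rewrite /K; move: isz; lia.
by rewrite scaler_sumr; apply: eq_bigr => m _; rewrite scalerA.
Qed.

End PhiBeta.

(** * Vacuum functionals *)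

Section Functionals.
Context (k : fieldType) (char0 : [pchar k] =i pred0) (beta : k).
Context (bracket : fockE k -> fockF k -> k) (bracketP : vacuum_pairing bracket).
Local Notation E := (fockE k).
Local Notation c := (beta / 2).
Local Notation expT := (op_exp (Theta beta)).
Implicit Types (w : E) (m n : int).

(** [vev], [vev1], [vev2], [vev3], [vev4] absorb the operators of the correlator one at a time,
    starting from the side of [|0>]. *)
Definition vev w : k^o := bracket w (ket0 k).

Lemma vev_linear : linear vev.
Proof. by case: bracketP => lin1 _ _ _ _ a u v; apply: (lin1 (ket0 k)). Qed.

Lemma vev_bra0 : vev (bra0 k) = 1.
Proof. by case: bracketP. Qed.

Lemma vev_rphi_neg w n : n < 0 -> vev (rphi w n) = 0.
Proof.
move=> n0; case: bracketP => _ lin2 assoc _ _.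
rewrite /vev /rphi assoc -[n]opprK ket0_phi ?oppr_gt0 //.
by have := lin2 w (-1) 0 0; rewrite scaleN1r oppr0 addr0 mulN1r addNr.
Qed.

(** One of [i] and [- i - m] is negative, and the two modes anticommute because their indices add up
    to [- m]; so a mode killing [|0>] can be moved next to it. *)
Lemma vev_bop (m : nat) w : odd m -> vev (bop m%:Z w) = 0.
Proof.
move=> om; have m0 : m%:Z != 0 by lia.
have [N wN] := vanish_exists w.
rewrite (bopE m0 wN (ltnSn _)) (linZ vev_linear) (lin_sum vev_linear) big1 ?scaler0 // => i _.
rewrite /quad (linZ vev_linear); have [i0|i0] := ltP i 0.
  by rewrite vev_rphi_neg ?scaler0.
rewrite rphiC (_ : (_ == 0) = false); last by lia.
rewrite mulr0 scale0r (linB vev_linear).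
by rewrite (lin0 vev_linear) vev_rphi_neg ?subr0 ?scaler0 //; lia.
Qed.

Definition vev1 w : k^o := vev (expT w).

Lemma vev1_linear : linear vev1.
Proof. by move=> a u v; rewrite /vev1 (expTheta_linear beta) vev_linear. Qed.

Lemma vev1_bop (l : nat) w : odd l -> vev1 (bop l%:Z w) = c ^+ l * vev1 w.
Proof.
move=> ol; rewrite /vev1 expTheta_bop // (linD vev_linear) vev_bop // add0r.
exact: (linZ vev_linear).
Qed.

Lemma vev_phi_beta_neg n w : n < 0 -> vev (phi_beta beta n w) = 0.
Proof.
move=> n0; have [N wN] := vanish_exists w.
rewrite phi_betaE (shift_sum_morph beta _ vev_linear (vanish_rphi_high wN)).
apply: fsbig1 => m _; have [m0|m0] := ltP m 0.
  by rewrite vev_rphi_neg // scaler0.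
by rewrite shift_coef_sign ?scale0r // m0 leNgt n0.
Qed.

Definition vev2 w : k^o := vev1 (phi_beta beta 0 w).

Lemma vev2_linear : linear vev2.
Proof. by move=> a u v; rewrite /vev2 (phi_beta_linear beta) vev1_linear. Qed.

Lemma vev1_phi_beta_neg (i : nat) w :
  vev1 (phi_beta beta (- i%:Z) w) = (- beta) ^+ i * vev2 w.
Proof.
elim: i => [|i IHi]; first by rewrite oppr0 mul1r.
rewrite exprS -mulrA -IHi /vev1.
have := expTheta_phi_beta char0 beta (- i.+1%:Z) w.
rewrite (_ : - i.+1%:Z + 1 = - i%:Z); last by lia.
move=> /(congr1 vev); rewrite vev_phi_beta_neg; last by lia.
rewrite (linD vev_linear) (linZ vev_linear) => /eqP; rewrite addr_eq0 => /eqP ->.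
by rewrite mulNr.
Qed.

(** The exponential contributes [c^l], and the field contributes [(w + c)^l] evaluated at
    [w = - beta], which is [(-c)^l]; for odd [l] these cancel. *)
Lemma vev2_bop (l : nat) w : odd l -> vev2 (bop l%:Z w) = 0.
Proof.
move=> ol; rewrite /vev2 phi_beta_bop // (linD vev1_linear) vev1_bop //.
rewrite -/(vev2 w) /polact (lin_sum vev1_linear).
under eq_bigr => i _.
  rewrite (linZ vev1_linear) sub0r vev1_phi_beta_neg.
  rewrite [_ *: _]mulrA; over.
rewrite -mulr_suml -horner_coef horner_exp !hornerE -mulrDl.
have -> : - beta + c = - c by have := natr_neq0 char0 1; move=> two0; field.
by rewrite exprNn -signr_odd ol mulN1r subrr mul0r.
Qed.

Lemma rphi00 w : rphi (rphi w 0) 0 = w.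
Proof.
have two0 := natr_neq0 char0 1; apply: (scalerI two0).
rewrite scaler_nat mulr2n [LHS](opE_anticomm w 0 0) addr0 eqxx expr0z !mulr1 //.
Qed.

Lemma vanish_bra0_phi0 : vanish 0 (rphi (bra0 k) 0).
Proof. exact: (vanish_rphi (n := 0) (@vanish_bra0 k)). Qed.

(** [e^Theta] fixes [<0|phi_0], so [expTheta_conj] becomes a recurrence in the index, started by
    [phi_0^2 = 1]. Its solution is again the expansion of [(1 - ct)/(1 + ct)]. *)
Lemma vev1_bra0_phi0 (j : nat) :
  vev1 (rphi (rphi (bra0 k) 0) (- j%:Z)) = if j == 0%N then 1 else 2 * (- c) ^+ j.
Proof.
set v := rphi (bra0 k) 0; have v0 : vanish 0 v := vanish_bra0_phi0.
have conj n : vev1 (rphi v n) + c * vev1 (rphi v (n + 1)) =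
              vev (rphi v n) - c * vev (rphi v (n + 1)).
  have := congr1 vev (expTheta_conj char0 beta v n); rewrite (expTheta_id beta v0).
  by rewrite (linD vev_linear) (linB vev_linear) !(linZ vev_linear).
have b0 : vev1 (rphi v 0) = 1.
  have := conj 0; rewrite add0r (vanish_rphi0 (n := 1) v0) //.
  rewrite (lin0 vev1_linear) (lin0 vev_linear).
  by rewrite !mulr0 addr0 subr0 rphi00 vev_bra0.
case: j => [|j] /=; first by rewrite oppr0.
elim: j => [|j IHj].
  have := conj (-1); rewrite addNr b0 vev_rphi_neg // rphi00 vev_bra0 sub0r mulr1.
  by move=> /(canRL (addrK _)) ->; rewrite expr1; move: (beta / 2) => t; ring.
have := conj (- j.+2%:Z); rewrite (_ : - j.+2%:Z + 1 = - j.+1%:Z); last by lia.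
rewrite !vev_rphi_neg; [|lia..].
rewrite mulr0 subr0 IHj => /eqP; rewrite addr_eq0 => /eqP ->.
by rewrite [in RHS]exprS; move: (beta / 2) => t; ring.
Qed.

(** Among the modes of [phi_0^(beta)], only [phi_(-n)] fails to anticommute with [phi_n]. *)
Lemma phi_beta_rphi n w :
  phi_beta beta 0 (rphi w n) =
  (2 * (-1) ^ n * shift_coef beta (- n) 0) *: w - rphi (phi_beta beta 0 w) n.
Proof.
have [N wN] := vanish_exists w; have wN' := vanish_rphi_high wN.
rewrite !phi_betaE (shift_sum_morph beta _ (rphi_linear n) wN').
pose K := (N + absz n).+2.
rewrite !(@shift_sumE _ _ _ (N + absz n)%N K) //; first last.
- move=> m Nm; rewrite rphiC (wN' m) ?rphi0 ?subr0; last by lia.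
  by rewrite (_ : (_ == 0) = false) ?mulr0 ?scale0r //; lia.
- by move=> m Nm; rewrite wN' ?rphi0 //; lia.
transitivity (\sum_(m <- zrange K)
  ((shift_coef beta m 0 * (2 * (-1) ^ n * (n + m == 0)%:R)) *: w
   - shift_coef beta m 0 *: rphi (rphi w m) n)).
  by apply: eq_bigr => m _; rewrite rphiC scalerBr scalerA.
rewrite sumrB; congr (_ - _).
rewrite (bigD1_seq (- n)) ?zrange_uniq ?mem_zrange //=; last by lia.
rewrite big1 ?addr0 => [|m mn]; last first.
  by rewrite (_ : (_ == 0) = false) ?mulr0 ?scale0r //; lia.
by rewrite subrr eqxx mulr1 mulrC.
Qed.

Lemma phi_beta0_bra0 : phi_beta beta 0 (bra0 k) = rphi (bra0 k) 0.
Proof.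
rewrite phi_betaE /shift_sum (@fsbigT_seq _ _ [:: 0]) //.
  by rewrite big_seq1 shift_coef0n eqxx scale1r.
move=> m; rewrite mem_seq1 => m0; have [mlt0|mgt0] := ltP m 0.
  by rewrite shift_coef_low ?scale0r.
by rewrite (vanish_rphi0 (@vanish_bra0 k)) ?scaler0 // lt_def m0.
Qed.

(** For [n = - j] with [j > 0] the contraction [2 (-c)^j] cancels the value given by
    [vev1_bra0_phi0]; at [j = 0] the difference is [2 - 1]. *)
Lemma vev2_bra0 n : n <= 0 -> vev2 (rphi (bra0 k) n) = (n == 0)%:R.
Proof.
move=> n0; have [j ->] : exists j : nat, n = - j%:Z by exists (absz n); lia.
rewrite /vev2 phi_beta_rphi (linB vev1_linear) (linZ vev1_linear) phi_beta0_bra0.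
rewrite vev1_bra0_phi0 {1}/vev1 (expTheta_id _ (@vanish_bra0 k)) vev_bra0.
rewrite opprK shift_coefn0 signzN oppr_eq0.
rewrite -exprnP [_ *: _]mulr1; case: j {n0} => [|j] /=.
  by rewrite !expr0 !mulr1 -[2]/(1 + 1) addrK.
by rewrite -mulrA -exprMn mulN1r subrr.
Qed.

Definition vev3 w : k^o := vev2 (expT w).

Lemma vev3_linear : linear vev3.
Proof. by move=> a u v; rewrite /vev3 (expTheta_linear beta) vev2_linear. Qed.

Lemma vev3_bop (l : nat) w : odd l -> vev3 (bop l%:Z w) = c ^+ l * vev3 w.
Proof.
move=> ol; rewrite /vev3 expTheta_bop // (linD vev2_linear) vev2_bop // add0r.
exact: (linZ vev2_linear).
Qed.

Definition vev4 w n : k^o := vev3 (phi_beta beta n w).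

Lemma vev4_linear n : linear (vev4^~ n).
Proof. by move=> a u v; rewrite /vev4 (phi_beta_linear beta) vev3_linear. Qed.

(** [(z + c)^l] comes from the field and [c^l] from the exponential next to it; what remains on the
    right kills [b_l] by [vev2_bop]. *)
Lemma vev4_bop (l : nat) n w : odd l ->
  vev4 (bop l%:Z w) n = polact (('X + c%:P) ^+ l + (c ^+ l)%:P) (vev4 w) n.
Proof.
move=> ol; rewrite polactD polactC /vev4 phi_beta_bop // (linD vev3_linear) vev3_bop //.
rewrite addrC /polact (lin_sum vev3_linear); congr (_ + _).
by apply: eq_bigr => i _; rewrite (linZ vev3_linear).
Qed.

(** The two-point function multiplied by [1 + beta/z]: after conjugation only the mode [phi_0] of
    [<0|phi(z + c)] survives, by [vev2_bra0]. *)
Lemma vev4_bra0_rec n :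
  vev4 (bra0 k) n + beta * vev4 (bra0 k) (n + 1) = (n == 0)%:R.
Proof.
have := congr1 vev2 (expTheta_phi_beta char0 beta n (bra0 k)).
rewrite (linD vev2_linear) (linZ vev2_linear) -/(vev3 _) -/(vev4 _ _) => ->.
rewrite (expTheta_id _ (@vanish_bra0 k)) phi_betaE.
rewrite (shift_sum_morph beta _ vev2_linear (vanish_rphi_high (N := 0) (@vanish_bra0 k))).
rewrite /shift_sum (@fsbigT_seq _ _ [:: 0]) //.
  by rewrite big_seq1 vev2_bra0 // shift_coef0n eqxx [_ *: _]mulr1.
move=> m; rewrite mem_seq1 => m0; have [mlt0|mgt0] := ltP m 0.
  by rewrite vev2_bra0 ?(negPf m0) ?scaler0 // ltW.
rewrite (vanish_rphi0 (@vanish_bra0 k)) ?(lin0 vev2_linear) ?scaler0 // lt_def m0 //.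
Qed.

(** The recurrence alone does not fix an expansion of [1/(1 + beta/z)]. For [n > 0] every mode
    occurring in [phi_n^(beta)] kills [<0|], and this selects the expansion in [z^-1]. *)
Lemma vev4_bra0 n :
  vev4 (bra0 k) n = if n is Posz j.+1 then 0 else (- beta) ^+ absz n.
Proof.
have pos m : 0 < m -> vev4 (bra0 k) m = 0.
  move=> m0; rewrite /vev4 phi_betaE [shift_sum _ _ _]fsbig1 ?(lin0 vev3_linear) //.
  move=> i _; have [im|mi] := ltP i m; first by rewrite shift_coef_low ?scale0r.
  by rewrite (vanish_rphi0 (@vanish_bra0 k)) ?scaler0 //; lia.
case: n => [[|j]|j] /=; last 1 first.
- rewrite NegzE; elim: j => [|j IHj].
    have := vev4_bra0_rec (-1); rewrite addNr => /eqP; rewrite addr_eq0 => /eqP ->.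
    have := vev4_bra0_rec 0; rewrite (pos (0 + 1)) // mulr0 addr0 => ->.
    by rewrite mulr1 expr1.
  have := vev4_bra0_rec (- j.+2%:Z).
  rewrite (_ : - j.+2%:Z + 1 = - j.+1%:Z); last by lia.
  by rewrite IHj => /eqP; rewrite addr_eq0 => /eqP ->; rewrite [RHS]exprS mulNr.
- by have := vev4_bra0_rec 0; rewrite (pos (0 + 1)) // mulr0 addr0 => ->.
by rewrite pos.
Qed.

End Functionals.

(** * The Hamiltonian and its exponential *)

Section CmonomFactors.
Context (I : choiceType).
Implicit Types (a d : {cmonom I}).

Lemma divcmK i a : (0 < a i)%N -> (ucm i * divcm a (ucm i))%M = a.
Proof.
move=> ai; apply/cmonomP => j; rewrite cmM divcmE cmU.
by case: eqP => [<-|]; rewrite ?subn0 // subnKC.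
Qed.

Lemma fsbig_ucm_factors (V : nmodType) a (F : I -> {cmonom I} -> V) :
  \sum_(d \in [set d : I * {cmonom I} | (ucm d.1 * d.2)%M = a]%classic) F d.1 d.2 =
  \sum_(i <- finsupp a) F i (divcm a (ucm i)).
Proof.
pose h i := (i, divcm a (ucm i)).
rewrite (fsbigE [seq h i | i <- finsupp a]).
- rewrite big_map big_seq_cond [RHS]big_seq; apply: eq_bigl => i.
  case ia: (i \in finsupp a) => //=; rewrite mem_set //= divcmK //.
  by rewrite lt0n cmE_neq0.
- by rewrite map_inj_uniq // => i j [].
- move=> d /= /mapP[i ia ->] /=; rewrite divcmK //.
  by rewrite lt0n cmE_neq0.
move=> [i d] /= ida; have ai : (0 < a i)%N by rewrite -ida cmM cmUU.
case/negP; apply/mapP; exists i; first by rewrite -cmE_neq0 -lt0n.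
by rewrite /h; congr (_, _); apply: (@ucmMI _ i); rewrite divcmK.
Qed.
End CmonomFactors.

Section HamiltonianAction.
Context (k : fieldType) (char0 : [pchar k] =i pred0) (beta : k).
Local Notation c := (beta / 2).

(** The eigenvalue of [(2/m) b_m^(beta)] on the generating function in [z = 'X]
    of the functionals [vev4]. *)
Definition ham_poly (m : nat) : {poly k} :=
  m%:R^-1 *: ('X ^+ m - (- 'X - beta%:P) ^+ m - ((- beta) ^+ m)%:P).

(** The substitution of [- X] for [X] exchanges the two powers in [bop_poly]. *)
Lemma bop_poly_even m l : ~~ odd l -> (bop_poly beta m)`_l = 0.
Proof.
move=> el; rewrite /bop_poly coefZ coefB; set q := ('X - c%:P) ^+ m.
have -> : (- 'X - c%:P) ^+ m = q \Po (- 'X).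
  by rewrite /q rmorphXn /= rmorphB /= comp_polyX comp_polyC.
have -> : (q \Po - 'X)`_l = q`_l.
  rewrite coef_comp_poly -scaleN1r.
  under eq_bigr do rewrite exprZn coefZ coefXn.
  have [lq|ql] := ltnP l (size q).
    rewrite (bigD1 (Ordinal lq)) //= big1 ?addr0 => [|i il].
      by rewrite -signr_odd (negPf el) mul1r eqxx mulr1.
    rewrite (_ : (l == i) = false) ?mulr0 //; apply/negP => /eqP li.
    by case/eqP: il; apply: val_inj.
  rewrite nth_default // big1 // => i _.
  rewrite (_ : (l == i) = false) ?mulr0 //; apply/negbTE.
  by rewrite gtn_eqF // (leq_trans _ ql).
by rewrite subrr mulr0.
Qed.

(** At [X = z + c] the two powers become [z^m] and [(- z - beta)^m]; at [X = c] the first is 0,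
    since [m > 0], and the second is [(- beta)^m]. *)
Lemma bop_poly_eigenvalue m : (0 < m)%N ->
  (2 / m%:R) *: (bop_poly beta m \Po ('X + c%:P) + ((bop_poly beta m).[c])%:P) = ham_poly m.
Proof.
move=> m0; have two0 := natr_neq0 char0 1.
have cc : c + c = beta by field.
have -> : (bop_poly beta m).[c] = 2^-1 * - (- beta) ^+ m.
  rewrite /bop_poly hornerZ !hornerE subrr expr0n gtn_eqF // sub0r.
  by rewrite -[in LHS]opprD cc.
have -> : bop_poly beta m \Po ('X + c%:P) = 2^-1 *: ('X ^+ m - (- 'X - beta%:P) ^+ m).
  rewrite /bop_poly comp_polyZ rmorphB /= !rmorphXn /= !rmorphB /= !comp_polyC.
  rewrite rmorphN /= comp_polyX addrK (_ : - ('X + c%:P) - c%:P = - 'X - beta%:P) //.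
  by rewrite opprD -addrA -opprD -rmorphD /= cc.
rewrite polyCM mul_polyC -scalerDr scalerA rmorphN /=; congr (_ *: _).
by rewrite mulrAC divff // mul1r.
Qed.
End HamiltonianAction.

Section HamiltonianExponential.
Context (k : fieldType) (char0 : [pchar k] =i pred0) (beta : k).
Local Notation c := (beta / 2).
Local Notation hp := (ham_poly beta).
Implicit Types (a : {cmonom nat}).

(** The coefficient of the monomial [a] in [exp (sum_n h_n p_n)]. *)
Definition exp_ham_poly a : {poly k} :=
  \prod_(i <- finsupp a) ((a i)`!%:R^-1 *: hp i.+1 ^+ a i).

Lemma exp_ham_polyE (D : {fset nat}) a : (finsupp a `<=` D)%fset ->
  exp_ham_poly a = \prod_(i <- D) ((a i)`!%:R^-1 *: hp i.+1 ^+ a i).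
Proof.
move=> aD; apply: big_fset_incl => // i _; rewrite -cmE_eq0 => /eqP ->.
by rewrite fact0 invr1 scale1r expr0.
Qed.

(** Coefficient form of the fact that the derivative of that exponential in [p_(i+1)] is
    multiplication by [h_(i+1)]. *)
Lemma exp_ham_polyM i a :
  hp i.+1 * exp_ham_poly a = (a i).+1%:R *: exp_ham_poly (ucm i * a)%M.
Proof.
pose D := (i |` finsupp a)%fset; have iD : i \in D by rewrite fset1U1.
have DM : (finsupp (ucm i * a)%M `<=` D)%fset by rewrite mdomD mdomU.
rewrite (exp_ham_polyE (fsubsetUr _ _ : (finsupp a `<=` D)%fset)) (exp_ham_polyE DM).
rewrite [in LHS](big_fsetD1 i) // [in RHS](big_fsetD1 i) //=.
rewrite [in RHS]scalerAl mulrA; congr (_ * _).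
  rewrite cmM cmUU add1n factS natrM invfM scalerA mulrA divff ?(natr_neq0 char0) //.
  by rewrite mul1r -scalerAr exprS.
apply: eq_big_seq => j; rewrite in_fsetD1 => /andP[ji _].
by rewrite cmM cmU eq_sym (negPf ji).
Qed.

Lemma exp_ham_poly1 : exp_ham_poly 1%M = 1.
Proof. by rewrite /exp_ham_poly mdom1 big_nil. Qed.

Lemma bop_beta_linear m : linear (bop_beta beta m).
Proof.
move=> t u v; rewrite scaler_sumr -big_split; apply: eq_bigr => l _ /=.
have [el|ol] := boolP (~~ odd l); first by rewrite bop_poly_even // !scale0r scaler0 addr0.
rewrite negbK in ol; have l0 : l%:Z != 0 by case: (nat_of_ord l) ol.
by rewrite (linD (bop_linear l0)) (linZ (bop_linear l0)) scalerDr !scalerA [_ * t]mulrC.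
Qed.

Lemma ham_coef (f : fps nat (fockE k)) a :
  ham beta f a =
  \sum_(i <- finsupp a) (2 / i.+1%:R) *: bop_beta beta i.+1 (f (divcm a (ucm i))).
Proof.
exact: (fsbig_ucm_factors a (fun i d => (2 / i.+1%:R) *: bop_beta beta i.+1 (f d))).
Qed.

Lemma mdeg_divcm i a : (0 < a i)%N -> mdeg a = (mdeg (divcm a (ucm i))).+1.
Proof. by move=> ai; rewrite -{1}(divcmK ai) mdegM mdegU. Qed.

(** Each [ham] contributes exactly one variable, so every coefficient of the exponential receives a
    single term of the series. *)
Lemma iter_ham_eq0 j w a : mdeg a != j ->
  iter j (ham beta) (fun d => w *+ (d == 1%M)) a = 0.
Proof.
elim: j a => [|j IHj] a; first by rewrite mdeg_eq0 /= => /negPf ->.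
move=> aj; rewrite iterS ham_coef big_seq big1 // => i; rewrite -cmE_neq0 -lt0n => ai.
rewrite IHj ?(lin0 (bop_beta_linear _)) ?scaler0 //.
by move: aj; rewrite (mdeg_divcm ai).
Qed.

Lemma exp_hamE w a :
  exp_ham beta w a =
  ((mdeg a)`!%:R)^-1 *: iter (mdeg a) (ham beta) (fun d => w *+ (d == 1%M)) a.
Proof.
rewrite /exp_ham (@fsbigT_seq _ _ [:: mdeg a]) ?big_seq1 // => j.
by rewrite mem_seq1 eq_sym => /iter_ham_eq0 ->; rewrite scaler0.
Qed.

Context (bracket : fockE k -> fockF k -> k) (bracketP : vacuum_pairing bracket).
Local Notation vev4 := (vev4 beta bracket).
Let lin4 := vev4_linear beta bracketP.

Lemma vev4_bop_beta m w n : (0 < m)%N ->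
  vev4 ((2 / m%:R) *: bop_beta beta m w) n = polact (hp m) (vev4 w) n.
Proof.
move=> m0; rewrite (linZ (lin4 n)) -bop_poly_eigenvalue // polactZ; congr (_ *: _).
rewrite /bop_beta (lin_sum (lin4 n)) comp_polyE horner_coef rmorph_sum /= -big_split /=.
rewrite polact_sum; apply: eq_bigr => l _; rewrite (linZ (lin4 n)).
have [el|ol] := boolP (~~ odd l).
  by rewrite bop_poly_even // scale0r mul0r !scale0r addr0 -polyC0 polactC scale0r.
by rewrite negbK in ol; rewrite vev4_bop // polyCM mul_polyC -scalerDr polactZ.
Qed.

Lemma polact_const_linear (p : {poly k}) (b : k) (f : int -> k^o) n :
  polact p (fun j => b *: f j) n = b *: polact p f n.
Proof. by rewrite /polact scaler_sumr; apply: eq_bigr => i _; rewrite !scalerA mulrC. Qed.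

(** Under [vev4] the operators act by commuting polynomials, so each choice [i] of the last variable
    gives the same value with weight [a i]. The weights add up to [mdeg a = j + 1], which turns [j!]
    into [(j + 1)!]. *)
Lemma vev4_iter_ham j a n : mdeg a = j ->
  vev4 (iter j (ham beta) (fun d => bra0 k *+ (d == 1%M)) a) n =
  j`!%:R *: polact (exp_ham_poly a) (vev4 (bra0 k)) n.
Proof.
elim: j a n => [|j IHj] a n.
  by move=> /mdeg_eq0I ->; rewrite /= eqxx exp_ham_poly1 -polyC1 polactC !scale1r.
move=> aj; rewrite iterS ham_coef (lin_sum (lin4 n)).
transitivity (\sum_(i <- finsupp a)
    (a i)%:R *: (j`!%:R *: polact (exp_ham_poly a) (vev4 (bra0 k)) n)).
  rewrite big_seq [RHS]big_seq; apply: eq_bigr => i; rewrite -cmE_neq0 -lt0n => ai.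
  have dj : mdeg (divcm a (ucm i)) = j by move: aj; rewrite (mdeg_divcm ai) => -[].
  rewrite vev4_bop_beta //.
  under [polact _ _ _]eq_bigr do rewrite IHj //.
  rewrite -/(polact (hp i.+1) (fun m => j`!%:R *: polact _ _ m) n) polact_const_linear.
  rewrite -polactM exp_ham_polyM divcmK // polactZ !scalerA divcmE cmUU mulrC.
  by rewrite subn1 prednK.
rewrite -scaler_suml -natr_sum -mdegE aj scalerA; congr (_ *: _).
by rewrite factS natrM.
Qed.

Lemma vev4_exp_ham a n :
  vev4 (exp_ham beta (bra0 k) a) n = polact (exp_ham_poly a) (vev4 (bra0 k)) n.
Proof.
rewrite exp_hamE (linZ (lin4 n)) vev4_iter_ham // scalerA mulVf ?scale1r //.
exact: fact_neq0.
Qed.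

End HamiltonianExponential.

(** * Symmetric functions *)

(** Differentiates [G = 1/(1 - y)] when the derivative of [y] is [t y], rewriting [G y] as
    [G - 1]. *)
Lemma inverse_derivative (R : comNzRingType) (G y dG t : R) :
  G * (1 - y) = 1 -> dG * (1 - y) = t * (G * y) -> dG = t * (G * (G - 1)).
Proof.
move=> G1 dGy; have Gy : G * y = G - 1 by rewrite -G1 mulrBr mulr1 subKr.
by rewrite -[dG]mulr1 -G1 mulrCA dGy G1 mulrCA Gy.
Qed.

Section EulerDerivation.
Context (I : choiceType) (R : comNzRingType).
Local Notation S := (fps I R).
Implicit Types (f g : S) (m : {cmonom I}) (i j : I).

Lemma fps_varXM i n f m :
  (fps_var i ^+ n * f) m = if (n <= m i)%N then f (divcm m (xpow i n)) else 0.
Proof.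
elim: n f m => [|n IHn] f m.
  rewrite mul1r; congr (f _); apply/cmonomP => j.
  by rewrite divcmE xpow0 cm1 subn0.
rewrite exprS -mulrA; have [mi0|] := posnP (m i).
  by rewrite fps_varM0 // mi0.
move=> /ucm_factor[d ->]; rewrite fps_varM IHn cmM cmUU add1n ltnS.
case: ifP => // _; congr (f _); apply/cmonomP => j.
rewrite !divcmE cmM xpowS cmM; lia.
Qed.

Lemma fps_varX i n m : ((fps_var i : S) ^+ n) m = (m == xpow i n)%:R.
Proof.
elim: n m => [//|n IHn] m; rewrite exprS; have [mi0|] := posnP (m i).
  rewrite fps_varM0 //; case: eqP => // m_xpow.
  by move: mi0; rewrite m_xpow xpowE eqxx.
by move=> /ucm_factor[d ->]; rewrite fps_varM IHn xpowS eq_ucmM.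
Qed.

Lemma fpsM_coefD f g m : (f * g) m =
  \sum_(d <- divisors_of m) \sum_(e <- divisors_of m) (f d * g e) *+ ((d * e)%M == m).
Proof. exact: fps_mulDE. Qed.

(** The derivation [x_i d/dx_i]. *)
Definition euler i f : S := fun m => (m i)%:R * f m.

Lemma eulerB i f g : euler i (f - g) = euler i f - euler i g.
Proof. by apply/funext => m; rewrite /euler !fpsD_coef !fpsN_coef mulrBr. Qed.

Lemma eulerM i f g : euler i (f * g) = euler i f * g + f * euler i g.
Proof.
apply/funext => m; rewrite fpsD_coef /euler !fpsM_coefD mulr_sumr -big_split.
apply: eq_bigr => d _; rewrite mulr_sumr -big_split; apply: eq_bigr => e _ /=.
rewrite -mulrnDl; have [<-|] := eqVneq; last by rewrite !mulr0n mulr0.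
by rewrite !mulr1n cmM natrD; ring.
Qed.

Lemma euler_const i a : euler i (fps_const a) = 0.
Proof.
apply/funext => m; rewrite /euler /fps_const.
by have [->|] := eqVneq; rewrite ?cm1 ?mul0r // mulr0n mulr0.
Qed.

Lemma euler1 i : euler i 1 = 0.
Proof. exact: (euler_const i 1). Qed.

Lemma euler_varX i j n : euler i (fps_var j ^+ n) = ((i == j) * n)%:R * fps_var j ^+ n.
Proof.
apply/funext => m; rewrite /euler mulr_natl mulr_natl.
have -> : (fps_var j ^+ n *+ ((i == j) * n)%N) m = (fps_var j ^+ n : S) m *+ ((i == j) * n)%N.
  by elim: (_ * n)%N => [|p IHp]; rewrite ?mulr0n // !mulrS fpsD_coef IHp.
rewrite fps_varX; have [->|] := eqVneq m (xpow j n); last by rewrite !mul0rn.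
by rewrite xpowE eq_sym; case: eqP => _; rewrite ?mul1n ?mul0n.
Qed.

Lemma euler_var i j : euler i (fps_var j) = (i == j)%:R * fps_var j.
Proof. by rewrite -[fps_var j]expr1 euler_varX muln1. Qed.

Lemma euler_geometric i j a :
  euler i (geometric a j) = (i == j)%:R * (geometric a j * (geometric a j - 1)).
Proof.
have G1 := geometricP a j; apply: (inverse_derivative G1).
have := congr1 (euler i) G1; rewrite eulerM eulerB !euler1 eulerM euler_const.
rewrite mul0r !add0r euler_var => /eqP; rewrite addr_eq0 mulrN opprK => /eqP ->.
by move: (geometric a j) (fps_const a) (fps_var j) => G x y; ring.
Qed.

Lemma fps_mul_coef1 f g : (f * g) 1%M = f 1%M * g 1%M.
Proof.
rewrite fpsM_coef (fsbigE [:: (1%M, 1%M)]) //=.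
- by rewrite big_cons big_nil mem_set /= ?mul1m // addr0.
- by move=> d /=; rewrite inE => /eqP -> /=; rewrite mul1m.
by move=> [d e] /= /unitm[-> ->]; rewrite mem_seq1 eqxx.
Qed.

End EulerDerivation.

Lemma invr_quotient (R : comUnitRingType) (x y v G : R) :
    v \is a GRing.unit -> G * (v - y * x) = 1 ->
  (1 + y * x) / (1 + y * (- x / v)) = (1 + y * x) * v * G.
Proof.
move=> vU G1; have wU : v - y * x \is a GRing.unit by apply/unitrPr; exists G; rewrite mulrC.
have -> : 1 + y * (- x / v) = (v - y * x) / v by rewrite mulrBl divrr // mulNr mulrN mulrA.
by rewrite (canRL (mulrK wU) G1) mul1r invrM ?unitrV // invrK mulrA.
Qed.

(** Adds the logarithmic derivatives [t (1 - Gu)], [t (1 - Gv)] and [t (G - 1)] of the three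
    factors. *)
Lemma log_derivative3 (R : comNzRingType) (t u v G Gu Gv du dv dG : R) :
    Gu * u = 1 -> Gv * v = 1 -> du = t * (u - 1) -> dv = t * (v - 1) ->
    dG = t * (G * (G - 1)) ->
  (du * v + u * dv) * G + u * v * dG = t * ((G - Gu - Gv + 1) * (u * v * G)).
Proof.
move=> Gu1 Gv1 -> -> ->.
have -> : (G - Gu - Gv + 1) * (u * v * G) =
  G * (u * v * G) - (Gu * u) * (v * G) - (Gv * v) * (u * G) + u * v * G by ring.
by rewrite Gu1 Gv1; ring.
Qed.

Section GeometricProduct.
Context (R : comNzRingType).
Implicit Types (f : fps nat R) (m : {cmonom nat}).

Lemma geometricM a i f m :
  (geometric a i * f) m = \sum_(n < (m i).+1) a ^+ n * f (divcm m (xpow i n)).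
Proof.
(* [g] is the expected product; multiplying it by [1 - a x_i] telescopes back to [f]. *)
pose g : fps nat R := fun d => \sum_(n < (d i).+1) a ^+ n * f (divcm d (xpow i n)).
suff fE : f = (1 - fps_const a * fps_var i) * g.
  by rewrite [in LHS]fE mulrA geometricP mul1r.
apply/funext => d; rewrite mulrBl mul1r -mulrA fpsD_coef fpsN_coef fps_constM.
have divcm1 (e : {cmonom nat}) : divcm e (xpow i 0) = e.
  by apply/cmonomP => j; rewrite divcmE xpow0 cm1 subn0.
have [di0|] := posnP (d i).
  by rewrite fps_varM0 // mulr0 subr0 /g di0 big_ord1 divcm1 expr0 mul1r.
move=> /ucm_factor[e ->]; rewrite fps_varM /g cmM cmUU add1n big_ord_recl divcm1.
rewrite expr0 mul1r mulr_sumr -addrA -sumrB big1 ?addr0 // => n _.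
rewrite lift0 exprS mulrA (_ : divcm _ (xpow i n.+1) = divcm e (xpow i n)) ?subrr //.
by apply/cmonomP => j; rewrite !divcmE xpowS !cmM subnDl.
Qed.
End GeometricProduct.

(** * Logarithmic derivatives of the factors of the infinite product *)

Section FactorSeries.
Context (k : fieldType) (char0 : [pchar k] =i pred0) (beta : k).
Local Notation S := (fps nat {poly k}).
Local Notation F := (GQ_factor beta).
Implicit Types (f g : S) (m : {cmonom nat}).

(** The sum of [n h_n x_i^n] over [n >= 1]. The final [1] cancels the constant terms of the three
    geometric series. *)
Definition ham_series i : S := geometric 'X i - geometric (- 'X - beta%:P) i
  - geometric (- beta)%:P i + 1.

(** Because [1 + (z + beta) xbar = (1 - z x)/(1 + beta x)]. *)
Lemma GQ_factorE i : F i =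
  (1 - fps_const (- 'X - beta%:P) * fps_var i) * (1 - fps_const (- beta)%:P * fps_var i)
  * geometric 'X i.
Proof.
have Nx (a : {poly k}) : 1 - fps_const (- a) * fps_var i = 1 + fps_const a * fps_var i :> S.
  by rewrite rmorphN mulNr opprK.
rewrite -opprD !polyCN !Nx /GQ_factor; apply: invr_quotient.
  by rewrite -Nx fps_unit_linear.
rewrite -[RHS](geometricP 'X i); congr (_ * _).
by rewrite rmorphD /= mulrDl opprD addrA addrAC addrK.
Qed.

Lemma GQ_factor_coef1 i : F i 1%M = 1.
Proof.
have lin (a : {poly k}) : (1 - fps_const a * fps_var i : S) 1%M = 1.
  by rewrite fpsD_coef fpsN_coef fps_constM fps1_coef eqxx /fps_var eq_sym cm1_eq1 mulr0 subr0.
by rewrite GQ_factorE !fps_mul_coef1 !lin !mul1r /geometric cm1 xpow0 eqxx expr0.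
Qed.

Lemma euler_GQ_factor i j : euler i (F j) = (i == j)%:R * (ham_series j * F j).
Proof.
have lin (a : {poly k}) : euler i (1 - fps_const a * fps_var j) =
    (i == j)%:R * (1 - fps_const a * fps_var j - 1).
  rewrite eulerB euler1 eulerM euler_const mul0r !add0r euler_var.
  by move: (fps_const a) (fps_var j) (_%:R) => x y t; ring.
rewrite GQ_factorE eulerM eulerM; apply: log_derivative3.
- exact: geometricP.
- exact: geometricP.
- exact: lin.
- exact: lin.
exact: euler_geometric.
Qed.

Lemma euler_GQ_prod i N : (i < N)%N ->
  euler i (\prod_(j < N) F j) = ham_series i * \prod_(j < N) F j.
Proof.
suff eulerN : euler i (\prod_(j < N) F j) =
    (i < N)%:R * (ham_series i * \prod_(j < N) F j).
  by move=> iN; rewrite eulerN iN mul1r.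
elim: N => [|N IHN]; first by rewrite big_ord0 euler1 mul0r.
rewrite big_ord_recr /= eulerM IHN euler_GQ_factor ltnS [(i <= N)%N]leq_eqVlt.
have [->|_] := eqVneq i N.
  by rewrite ltnn mul0r mul0r add0r !mul1r mulrCA.
by rewrite mul0r mulr0 addr0 !mulrA.
Qed.

Lemma GQ_prod_coef1 N : (\prod_(j < N) F j) 1%M = 1.
Proof.
elim: N => [|N IHN]; first by rewrite big_ord0 fps1_coef eqxx.
by rewrite big_ord_recr /= fps_mul_coef1 IHN GQ_factor_coef1 mulr1.
Qed.

Lemma ham_polyE n : n.+1%:R *: ham_poly beta n.+1 =
  'X ^+ n.+1 - (- 'X - beta%:P) ^+ n.+1 - (- beta)%:P ^+ n.+1.
Proof.
by rewrite /ham_poly scalerA divff ?(natr_neq0 char0) // scale1r rmorphXn.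
Qed.

Lemma ham_seriesM i f m : (ham_series i * f) m =
  \sum_(n < m i) (n.+1%:R *: ham_poly beta n.+1) * f (divcm m (xpow i n.+1)).
Proof.
have geomM (u : {poly k}) : (geometric u i * f) m =
    f m + \sum_(n < m i) u ^+ n.+1 * f (divcm m (xpow i n.+1)).
  rewrite geometricM big_ord_recl expr0 mul1r; congr (f _ + _).
  by apply/cmonomP => j; rewrite divcmE xpow0 cm1 subn0.
rewrite !mulrDl !mulNr mul1r !fpsD_coef !fpsN_coef !geomM.
under [RHS]eq_bigr do rewrite ham_polyE !mulrBl.
by rewrite !sumrB; ring.
Qed.

Lemma natr_poly_neq0 n : n.+1%:R != 0 :> {poly k}.
Proof. by rewrite -polyC_natr polyC_eq0 natr_neq0. Qed.

Lemma mdeg_divcm_xpow i n m : (n < m i)%N -> (mdeg (divcm m (xpow i n.+1)) < mdeg m)%N.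
Proof.
move=> nm; have -> : m = (ucm i * (xpow i n * divcm m (xpow i n.+1)))%M.
  apply/cmonomP => j; rewrite !cmM divcmE cmU !xpowE.
  by case: eqP => [<-|_]; lia.
rewrite mdegM mdegU mdegM add1n ltnS (_ : divcm _ _ = divcm m (xpow i n.+1)) ?leq_addl //.
congr (divcm _ _); apply/cmonomP => j; rewrite !cmM divcmE cmU !xpowE.
by case: eqP => [<-|_]; lia.
Qed.

(** At a monomial with [m i > 0], the equation for [i] expresses [m i] times the coefficient through
    coefficients of smaller degree. Only variables below [N] are allowed in [m], since the product
    of the first [N] factors satisfies the equations for these alone. *)
Lemma euler_unique N f g : f 1%M = g 1%M ->
    (forall i, (i < N)%N -> euler i f = ham_series i * f) ->
    (forall i, (i < N)%N -> euler i g = ham_series i * g) ->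
  forall m, (forall i, (N <= i)%N -> m i = 0%N) -> f m = g m.
Proof.
move=> fg1 fE gE m; have [D] := ubnP (mdeg m); elim: D m => // D IHD m; rewrite ltnS => mD mN.
have [->//|m1] := eqVneq m 1%M.
have [i mi] : exists i, (0 < m i)%N.
  apply: contrapT => noi; case/eqP: m1; apply/cmonomP => i; rewrite cm1.
  by apply/eqP; rewrite -leqn0 leqNgt; apply/negP => mi; apply: noi; exists i.
have iN : (i < N)%N by rewrite ltnNge; apply/negP => /mN mi0; rewrite mi0 in mi.
have mi0 : (m i)%:R != 0 :> {poly k} by rewrite -(prednK mi) natr_poly_neq0.
apply: (mulfI mi0); rewrite -[LHS]/(euler i f m) -[RHS]/(euler i g m) fE // gE //.
rewrite !ham_seriesM; apply: eq_bigr => n _; congr (_ * _); apply: IHD.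
  by apply: leq_trans mD; apply: mdeg_divcm_xpow.
by move=> j /mN; rewrite divcmE => ->.
Qed.

End FactorSeries.

Lemma fsumrZ (R : idomainType) (I : choiceType) (b : R) (F : I -> R) :
  \sum_(i \in [set: I]%classic) b * F i = b * \sum_(i \in [set: I]%classic) F i.
Proof. by rewrite mulr_fsumr. Qed.

(** * Power sums: derivatives and degree bounds *)

Section PowerSums.
Context (k : fieldType).
Local Notation S := (fps nat k).
Implicit Types (f g : S) (a m : {cmonom nat}).

Lemma power_sum_coef n m :
  power_sum k n.+1 m = `[< exists i, m = xpow i n.+1 >]%:R.
Proof.
rewrite /power_sum; case: asboolP => [[i ->]|noi].
  rewrite (@fsbigT_seq _ _ [:: i]) //.
    by rewrite big_seq1 fps_varX eqxx.
  move=> j; rewrite mem_seq1 fps_varX => ji; case: eqP => //.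
  move=> /(congr1 (fun d : {cmonom nat} => d i)).
  by rewrite !xpowE eqxx (negPf ji).
by rewrite fsbig1 // => i _; rewrite fps_varX; case: eqP => // mi; case: noi; exists i.
Qed.

Lemma euler_power_sum i n :
  euler i (power_sum k n.+1) = n.+1%:R * fps_var i ^+ n.+1.
Proof.
apply/funext => m; rewrite /euler power_sum_coef.
have -> : (n.+1%:R * fps_var i ^+ n.+1) m = n.+1%:R * (fps_var i ^+ n.+1 : S) m.
  by rewrite -[n.+1%:R in LHS](rmorph_nat (@fps_const nat k)) fps_constM.
rewrite fps_varX; case: asboolP => [[j ->]|noi].
  rewrite xpowE; have [->|ji] := eqVneq j i; first by rewrite eqxx.
  rewrite mul0r; case: eqP => [|]; last by rewrite mulr0.
  move=> /(congr1 (fun d : {cmonom nat} => d i)).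
  by rewrite !xpowE eqxx (negPf ji).
by rewrite mulr0; case: eqP => [mi|]; rewrite ?mulr0 //; case: noi; exists i.
Qed.

Definition power_prod a : S := \prod_(i <- finsupp a) power_sum k i.+1 ^+ a i.
Definition weight a : nat := \sum_(i <- finsupp a) (a i * i.+1)%N.

Lemma power_prodM i a : power_prod (ucm i * a)%M = power_sum k i.+1 * power_prod a.
Proof.
pose D := (i |` finsupp a)%fset; have iD : i \in D by rewrite fset1U1.
have PE (d : {cmonom nat}) : (finsupp d `<=` D)%fset ->
    power_prod d = \prod_(i <- D) power_sum k i.+1 ^+ d i.
  by move=> dD; apply: big_fset_incl => // j _; rewrite -cmE_eq0 => /eqP ->; rewrite expr0.
rewrite (PE a) ?fsubsetUr // PE ?mdomD ?mdomU //.
rewrite [in LHS](big_fsetD1 i) // [in RHS](big_fsetD1 i) //=.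
rewrite mulrA cmM cmUU add1n exprS; congr (_ * _).
apply: eq_big_seq => j; rewrite in_fsetD1 => /andP[ji _].
by rewrite cmM cmU eq_sym (negPf ji).
Qed.

Lemma weightM i a : weight (ucm i * a)%M = (i.+1 + weight a)%N.
Proof.
pose D := (i |` finsupp a)%fset; have iD : i \in D by rewrite fset1U1.
have PE (d : {cmonom nat}) : (finsupp d `<=` D)%fset ->
    weight d = \sum_(i <- D) (d i * i.+1)%N.
  by move=> dD; apply: big_fset_incl => // j _; rewrite -cmE_eq0 => /eqP ->.
rewrite (PE a) ?fsubsetUr // PE ?mdomD ?mdomU //.
rewrite [in LHS](big_fsetD1 i) // [in RHS](big_fsetD1 i) //=.
rewrite addnA cmM cmUU add1n mulSn; congr (_ + _)%N.
apply: eq_big_seq => j; rewrite in_fsetD1 => /andP[ji _].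
by rewrite cmM cmU eq_sym (negPf ji).
Qed.

Lemma power_prod1 : power_prod 1%M = 1.
Proof. by rewrite /power_prod mdom1 big_nil. Qed.

Lemma weight1 : weight 1%M = 0%N.
Proof. by rewrite /weight mdom1 big_nil. Qed.

Lemma cmonom_ind (P : {cmonom nat} -> Prop) :
  P 1%M -> (forall i a, P a -> P (ucm i * a)%M) -> forall a, P a.
Proof.
move=> P1 PM a; have [D] := ubnP (mdeg a); elim: D a => // D IHD a; rewrite ltnS => aD.
have [->//|a1] := eqVneq a 1%M.
have [i ai] : exists i, (0 < a i)%N.
  apply: contrapT => noi; case/eqP: a1; apply/cmonomP => i; rewrite cm1.
  by apply/eqP; rewrite -leqn0 leqNgt; apply/negP => ai; apply: noi; exists i.
rewrite -(divcmK ai); apply/PM/IHD.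
by apply: leq_trans aD; rewrite [in leqRHS](mdeg_divcm ai).
Qed.

Definition order_ge n f := forall m, (mdeg m < n)%N -> f m = 0.

Lemma order_geM p q f g : order_ge p f -> order_ge q g -> order_ge (p + q) (f * g).
Proof.
move=> fp gq m mpq; rewrite fpsM_coef fsbig1 // => -[d e] /= de.
have [dp|pd] := ltnP (mdeg d) p; first by rewrite fp ?mul0r.
by rewrite gq ?mulr0 //; move: mpq; rewrite -de mdegM; lia.
Qed.

Lemma mdeg_xpow (i : nat) n : mdeg (xpow i n) = n.
Proof. by elim: n => [|n IHn]; rewrite ?mdeg1 // xpowS mdegM mdegU IHn. Qed.

Lemma order_power_sum n : order_ge n.+1 (power_sum k n.+1).
Proof.
move=> m mn; rewrite power_sum_coef; case: asboolP => // -[i mi].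
by move: mn; rewrite mi mdeg_xpow ltnn.
Qed.

Lemma order_power_prod a : order_ge (weight a) (power_prod a).
Proof.
elim/cmonom_ind: a => [|i a IHa]; first by rewrite weight1.
by rewrite weightM power_prodM; apply: order_geM => //; apply: order_power_sum.
Qed.

(** The chain rule, with [x_i d/dx_i p_(d+1) = (d + 1) x_i^(d+1)]. The bound [D] gives all the
    monomials considered one index range. *)
Lemma euler_power_prod i a (D : nat) : (forall j, (D <= j)%N -> a j = 0%N) ->
  euler i (power_prod a) =
  \sum_(d < D) (a d * d.+1)%:R * (fps_var i ^+ d.+1 * power_prod (divcm a (ucm (d : nat)))).
Proof.
elim/cmonom_ind: a => [|j a IHa] aD.
  by rewrite power_prod1 euler1 big1 // => d _; rewrite cm1 mul0r.
have jD : (j < D)%N.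
  by rewrite ltnNge; apply/negP => /aD; rewrite cmM cmUU.
rewrite power_prodM eulerM IHa => [|l /aD]; last by rewrite cmM; lia.
rewrite euler_power_sum mulr_sumr.
transitivity (\sum_(d < D) ((j == d)%:R * (d.+1%:R * (fps_var i ^+ d.+1 * power_prod a))
   + power_sum k j.+1 * ((a d * d.+1)%:R *
       (fps_var i ^+ d.+1 * power_prod (divcm a (ucm (d : nat))))))).
  rewrite big_split /=; congr (_ + _); rewrite (bigD1 (Ordinal jD)) //= eqxx.
  rewrite big1 ?addr0 ?mul1r ?mulrA // => d dj.
  rewrite (_ : (j == d) = false) ?mul0r //; apply/negbTE; apply: contra dj => /eqP jd.
  by apply/eqP/val_inj.
apply: eq_bigr => d _; rewrite cmM cmU.
(* If [a d = 0], the division of [a] by [ucm d] is not exact, but its coefficient is 0. *)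
have [ad|ad] := posnP (a d).
  rewrite ad mul0n mul0r mulr0 addr0; have [jd|] := eqVneq j (d : nat); last first.
    by move=> _; rewrite addn0 mul0n !mul0r.
  rewrite jd mul1r addn0 mul1n; congr (_ * (_ * power_prod _)).
  by apply: (@ucmMI _ (d : nat)); rewrite divcmK // cmM cmUU.
have aE : power_sum k j.+1 * power_prod (divcm a (ucm (d : nat))) =
    power_prod (divcm (ucm j * a)%M (ucm (d : nat))).
  rewrite -power_prodM; congr power_prod; apply: (@ucmMI _ (d : nat)).
  rewrite divcmK; last by rewrite cmM ltn_addl.
  by rewrite mulmA (mulmC (ucm (d : nat))) -mulmA divcmK.
rewrite [power_sum _ _ * _]mulrCA [power_sum _ _ * (_ * power_prod _)]mulrCA aE.
have [jd|] := eqVneq j (d : nat); last by move=> _; rewrite mul0r add0r.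
have -> : power_prod (divcm (ucm j * a)%M (ucm (d : nat))) = power_prod a.
  congr power_prod; apply: (@ucmMI _ (d : nat)); rewrite divcmK ?jd // cmM cmUU //.
by rewrite mul1r -mulrDl -natrD mulnDl mul1n.
Qed.

(** Its divisors form a finite set containing every [a] with [weight a <= D], hence all the
    power-sum monomials that contribute in degrees up to [D]. *)
Definition box (D : nat) : {cmonom nat} :=
  \big[mmul/mone]_(i < D) xpow (i : nat) D.

Lemma boxE D j : box D j = if (j < D)%N then D else 0%N.
Proof.
have -> : box D j = (\sum_(i < D) xpow (i : nat) D j)%N.
  by apply: (big_morph (fun d : {cmonom nat} => d j)) => [d e|]; rewrite ?cmM ?cm1.
case: ltnP => jD.
  rewrite (bigD1 (Ordinal jD)) //= xpowE eqxx big1 ?addn0 // => i ij.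
  by rewrite xpowE; case: eqP => // eij; case/eqP: ij; apply: val_inj.
by rewrite big1 // => i _; rewrite xpowE; case: eqP => // ij; have := ltn_ord i; lia.
Qed.

Lemma weight_ge a i : (a i * i.+1 <= weight a)%N.
Proof.
have [ia|ia] := boolP (i \in finsupp a); last first.
  by move: ia; rewrite -cmE_eq0 => /eqP ->.
by rewrite /weight (big_fsetD1 i) //= leq_addr.
Qed.

Lemma mem_box D a : (weight a <= D)%N -> a \in divisors_of (box D).
Proof.
move=> aD; apply: (@mem_divisors_of _ _ _ (divcm (box D) a)).
apply/cmonomP => i; rewrite cmM divcmE boxE; have := weight_ge a i.
case: ltnP => iD ai; first by rewrite subnKC //; nia.
by rewrite sub0n; nia.
Qed.

Lemma power_prod_box D a m : (mdeg m <= D)%N -> a \notin divisors_of (box D) ->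
  power_prod a m = 0.
Proof.
move=> mD /negP aD; apply: order_power_prod; rewrite ltnNge; apply/negP => am.
by apply: aD; apply: mem_box; apply: leq_trans mD.
Qed.

End PowerSums.

(** * The series [exp (sum_n h_n p_n(x))] and the infinite product *)

Section CauchyKernel.
Context (k : fieldType) (char0 : [pchar k] =i pred0) (beta : k).
Local Notation S := (fps nat {poly k}).
Local Notation Q := (exp_ham_poly beta).
Local Notation M := (power_prod k).
Implicit Types (a m : {cmonom nat}).

Definition sym_exp : S := fun m => \sum_(a \in [set: {cmonom nat}]%classic) M a m *: Q a.

Lemma sym_exp_box D m : (mdeg m <= D)%N ->
  sym_exp m = \sum_(a <- divisors_of (box D)) M a m *: Q a.
Proof.
move=> mD; apply: fsbigT_seq => [|a aD]; first exact: uniq_divisors_of.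
by rewrite (power_prod_box k mD) ?scale0r.
Qed.

Lemma divisors_ofP (I : choiceType) (m d : {cmonom I}) :
  d \in divisors_of m -> exists e, (d * e)%M = m.
Proof. by rewrite /divisors_of in_fset_set ?inE; [|exact: finite_divisors]. Qed.

Lemma mdeg_ge m i : (m i <= mdeg m)%N.
Proof.
have [im|] := boolP (i \in finsupp m); last by rewrite -cmE_eq0 => /eqP ->.
by rewrite mdegE (big_fsetD1 i im) /= leq_addr.
Qed.

Lemma fps_natM (R : comNzRingType) n (f : fps nat R) m : (n%:R * f) m = n%:R * f m.
Proof. by rewrite -[n%:R in LHS](rmorph_nat (@fps_const nat R)) fps_constM. Qed.

(** The chain rule again. In the terms of index [d], one factor [p_(d+1)] is split off [a], and
    [exp_ham_polyM] trades the multiplicity [a d] for [h_(d+1)]. *)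
Lemma euler_sym_exp i : euler i sym_exp = ham_series beta i * sym_exp.
Proof.
apply/funext => m; rewrite ham_seriesM // /euler; set D := mdeg m.
rewrite (@sym_exp_box D) // mulr_sumr.
pose T (d : nat) a := ((a d * d.+1)%:R *
  ((fps_var i ^+ d.+1 * M (divcm a (ucm d))) m : k)) *: Q a.
transitivity (\sum_(a <- divisors_of (box D)) \sum_(d < D) T d a).
  rewrite big_seq [RHS]big_seq; apply: eq_bigr => a /divisors_ofP[e ae].
  have aD j : (D <= j)%N -> a j = 0%N.
    move=> Dj; have := congr1 (fun d : {cmonom nat} => d j) ae.
    by rewrite /= cmM boxE ltnNge Dj /=; lia.
  rewrite -scaler_suml mulr_natl -scaler_nat scalerA; congr (_ *: _).
  rewrite -[LHS]/(euler i (M a) m) (euler_power_prod _ _ aD) fps_sum_coef.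
  by apply: eq_bigr => d _; rewrite fps_natM.
rewrite exchange_big (big_ord_widen D (fun n => n.+1%:R *: ham_poly beta n.+1 *
  sym_exp (divcm m (xpow i n.+1)))) ?mdeg_ge // [RHS]big_mkcond /=.
(* The box is not stable under splitting off [p_(d+1)], so the sum is first extended to all [a]. A
   nonzero term satisfies [weight a <= D], since splitting off [p_(d+1)] from [a] and [x_i^(d+1)]
   from [m] lowers both degrees equally. *)
apply: eq_bigr => d _; rewrite -(@fsbigT_seq _ _ _ (T d)) ?uniq_divisors_of //; last first.
  move=> a aD; rewrite /T; have [->|ad] := posnP (a d); first by rewrite mul0n mul0r scale0r.
  rewrite fps_varXM; case: ifP => di; last by rewrite mulr0 scale0r.
  rewrite order_power_prod ?mulr0 ?scale0r // ltnNge; apply: contra aD => wm.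
  apply: mem_box; rewrite -(divcmK ad) weightM.
  have mE : m = (xpow i d.+1 * divcm m (xpow i d.+1))%M.
    by apply/cmonomP => j; rewrite cmM divcmE xpowE; case: eqP => [<-|_]; lia.
  by rewrite /D [in leqRHS]mE mdegM mdeg_xpow leq_add2l.
rewrite -(fsbig_widen [set a : {cmonom nat} | (0 < a d)%N]%classic) //; last first.
  by move=> a /= [_ /negP]; rewrite -eqn0Ngt /T => /eqP ->; rewrite mul0n mul0r scale0r.
rewrite (reindex_fsbig (fun a => (ucm (d : nat) * a)%M)
  [set: {cmonom nat}]%classic); last first.
  split=> [a _|a b _ _ /ucmMI //|a /= ad]; first by rewrite /= cmM cmUU.
  by exists (divcm a (ucm (d : nat))) => //; rewrite divcmK.
transitivity (\sum_(a \in [set: {cmonom nat}]%classic) (d.+1%:R *: ham_poly beta d.+1) *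
   ((fps_var i ^+ d.+1 * M a) m *: Q a)).
  apply: eq_fsbigr => a _; rewrite /T.
  have -> : divcm (ucm (d : nat) * a)%M (ucm (d : nat)) = a.
    by apply: (@ucmMI _ (d : nat)); rewrite divcmK // cmM cmUU.
  rewrite cmM cmUU add1n natrM -scalerAl -scalerAr exp_ham_polyM // !scalerA.
  by congr (_ *: _); ring.
rewrite fsumrZ; under eq_fsbigr do rewrite fps_varXM.
by case: ltnP => di //; rewrite fsbig1 ?mulr0 // => a _; rewrite scale0r.
Qed.

Lemma sym_exp_coef1 : sym_exp 1%M = 1.
Proof.
rewrite /sym_exp (@fsbigT_seq _ _ [:: 1%M]) //.
  by rewrite big_seq1 power_prod1 exp_ham_poly1 fps1_coef eqxx scale1r.
move=> a; rewrite mem_seq1 => a1; rewrite order_power_prod ?scale0r // mdeg1 lt0n.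
apply: contra a1 => /eqP wa; apply/eqP/cmonomP => i; rewrite cm1.
by have := weight_ge a i; rewrite wa leqn0 muln_eq0 orbF => /eqP.
Qed.

Lemma finsupp_bound m : exists N, forall i, (N <= i)%N -> m i = 0%N.
Proof.
exists (\max_(i <- finsupp m) i).+1 => i Ni; apply/eqP; rewrite cmE_eq0.
apply/negP => im; move: Ni; rewrite ltnNge => /negP; apply.
by rewrite (big_fsetD1 i im) leq_maxl.
Qed.

(** A monomial involves finitely many variables, so [euler_unique] applies to all partial products
    that are long enough. As [xget] picks an unspecified limit, uniqueness of limits is used as
    well. *)
Lemma GQ_infprod : fps_infprod (GQ_factor beta) = sym_exp.
Proof.
have conv : fps_converges (fun N => \prod_(i < N) GQ_factor beta i) sym_exp.
  move=> m; have [N mN] := finsupp_bound m; exists N => n Nn.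
  apply: (@euler_unique _ char0 beta n).
  - by rewrite GQ_prod_coef1 sym_exp_coef1.
  - by move=> i; apply: euler_GQ_prod.
  - by move=> i _; apply: euler_sym_exp.
  - by move=> i ni; apply: mN; apply: leq_trans ni.
rewrite /fps_infprod; case: xgetP => [l _ lconv|/(_ sym_exp)] //.
apply/funext => m; have [N1 lN] := lconv m; have [N2 sN] := conv m.
by rewrite -(lN (maxn N1 N2)) ?leq_maxl // -(sN (maxn N1 N2)) ?leq_maxr.
Qed.

(** The prefactor [1/(1 + beta/z)] has the coefficients of the two-point function in [vev4_bra0];
    this gives [GQ] the shape of the correlator in [vev4_exp_ham]. *)
Lemma GQ_polact n m :
  GQ beta n m = polact (sym_exp m)
    (fun j => (if j is Posz i.+1 then 0 else (- beta) ^+ absz j) : k^o) n.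
Proof.
rewrite /GQ GQ_infprod; move: (sym_exp m) => p.
(* The exponent [i] of [z] taken from the product determines the exponent [i - n] of [z^-1] taken
   from the prefactor, which requires [n <= i]. *)
pose h (i : nat) := (absz (i%:Z - n), i).
rewrite (fsbigE [seq h i | i <- iota 0 (size p) & n <= i%:Z]).
- rewrite big_map big_filter_cond (_ : iota 0 (size p) = index_iota 0 (size p)); last first.
    by rewrite /index_iota subn0.
  rewrite big_mkord big_mkcond /polact; apply: eq_bigr => -[i ip] _ /=.
  case: ifP => [/andP[ni _]|].
    rewrite mulrC; have [t tE] : exists t : nat, i%:Z - n = t by exists (absz (i%:Z - n)); lia.
    by rewrite tE (_ : n - i%:Z = - t%:Z); [case: t tE|lia].
  move=> /negP ni; have [t tE] : exists t : nat, n - i%:Z = t.+1.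
    exists (absz (n - i%:Z)).-1; suff : ~~ (n <= i%:Z) by lia.
    by apply/negP => ni'; apply: ni; rewrite ni' mem_set //=; lia.
  by rewrite tE scaler0.
- by rewrite map_inj_uniq ?filter_uniq ?iota_uniq // => i j [].
- move=> d /= /mapP[i]; rewrite mem_filter => /andP[ni _] -> /=; lia.
move=> [d i] /= din; move=> /negP ni; rewrite nth_default ?mulr0 // leqNgt.
apply/negP => ip; apply: ni; apply/mapP; exists i.
  by rewrite mem_filter mem_iota /= ip andbT; lia.
by rewrite /h; congr (_, _); lia.
Qed.

End CauchyKernel.

Lemma Qbeta_char0 : [pchar Qbeta] =i pred0.
Proof.
apply/pcharf0P => n; rewrite -(rmorph_nat (@tofrac _)) tofrac_eq0.
by rewrite -polyC_natr polyC_eq0 Num.Theory.pnatr_eq0.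
Qed.

Theorem theorem6p1 (bracket : fockE Qbeta -> fockF Qbeta -> Qbeta)
    (bracketP : vacuum_pairing bracket) (n : int) :
  GQ beta n =
  at_power_sums (fun a : {cmonom nat} =>
    bracket (op_exp (Theta beta)
              (phi_beta beta 0
                (op_exp (Theta beta)
                  (phi_beta beta n
                    (exp_ham beta (bra0 Qbeta) a)))))
            (ket0 Qbeta)).
Proof.
have char0 := Qbeta_char0; apply/funext => m.
(* At a fixed monomial [m] in the [x] variables, both sides become sums over the same finite box of
   power-sum monomials. *)
rewrite (GQ_polact char0) (@sym_exp_box _ _ (mdeg m)) // polact_sum.
rewrite /at_power_sums (@fsbigT_seq _ _ (divisors_of (box (mdeg m)))); last 2 first.
- exact: uniq_divisors_of.
- move=> a /(power_prod_box Qbeta (leqnn (mdeg m))).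
  by rewrite /power_prod => ->; rewrite mulr0.
apply: eq_bigr => a _; rewrite polactZ [RHS]mulrC; congr (_ * _).
rewrite -[RHS]/(vev4 beta bracket (exp_ham beta (bra0 Qbeta) a) n).
rewrite (vev4_exp_ham char0 beta bracketP); apply: eq_bigr => i _.
by rewrite (vev4_bra0 char0 beta bracketP).
Qed.
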